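(* The formulas $$a\triangleright\rho:=a\rho,\qquad \omega\triangleright\rho:=\omega\wedge\rho+\langle\!\langle\omega,\rho\rangle\!\rangle,\qquad a\in\mathcal A,\ \omega\in\Gamma,\ \rho\in\Gamma^{\wedge},$$ define a representation of the quantum Clifford algebra $\mathrm{Cl}(\Gamma,\sigma,g)$ on Woronowicz' external algebra $\Gamma^{\wedge}$.
   Context: $\mathcal A$ is a cosemisimple Hopf $*$-algebra over $\mathbb C$ (so $\varDelta(a^* )=( *\otimes * )\varDelta(a)$ and every corepresentation is a direct sum of simple ones), with coproduct $\varDelta(a)=a_{(1)}\otimes a_{(2)}$, counit $\varepsilon$, antipode $S$. Repeated indices are summed. **Calculus.** $(\Gamma,d)$ is a finite dimensional left-covariant first order differential $*$-calculus over $\mathcal A$ with left coaction $\Delta_L$; $\Gamma_L$ is the space of left-invariant elements with basis $\theta_1,\dots,\theta_n$, and the quantum tangent space $\mathcal X\subset\mathcal A^\circ$ has the dual basis $X_1,\dots,X_n$, i.e. $da=a_{(1)}X_i(a_{(2)})\theta_i$. It is $S^2$-invariant: $S^2(\mathcal X)=\mathcal X$. If $S^2(X_i)=F^i_jX_j$, put $S^2(\theta_i):=F^j_i\theta_j$ and $S^2(a\rho)=S^2(a)S^2(\rho)$; this defines $S^2$ on $\Gamma$. Put $\omega(a)=S(a_{(1)})da_{(2)}$ and $\mathcal R_\Gamma=\{b\in\mathcal A: \omega(b)=0,\varepsilon(b)=0\}$. **Braiding.** $\sigma$ is an automorphism of the left-covariant $\mathcal A$-bimodule $\Gamma\otimes_{\mathcal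 A}\Gamma$ such that: $\sigma_{12}\sigma_{23}\sigma_{12}=\sigma_{23}\sigma_{12}\sigma_{23}$ on $\Gamma^{\otimes_{\mathcal A}3}$; $\omega(a_{(1)})\otimes\omega(a_{(2)})\in\ker(\mathrm{id}-\sigma)$ for $a\in\mathcal R_\Gamma$; $\sigma$ commutes with $S^2$ (where $S^2(\rho\otimes\rho')=S^2(\rho)\otimes S^2(\rho')$); and either $(\sigma\rho_2)^*=\sigma(\rho_2^* )$ for all $\rho_2$ or $(\sigma\rho_2)^*=\sigma^{-1}(\rho_2^* )$ for all $\rho_2\in\Gamma^{\otimes_{\mathcal A}2}$, where $(\rho\otimes\rho')^*=\rho'^*\otimes\rho^*$ up to sign. $A_k$ denotes Woronowicz' antisymmetrizer $A_k=\sum_{w\in S_k}(-1)^{\ell(w)}\sigma_w$ on $\Gamma^{\otimes_{\mathcal A}k}$ (so $A_1=\mathrm{id}$, $A_2=\mathrm{id}-\sigma$), $\Gamma^{\wedge k}=\Gamma^{\otimes_{\mathcal A}k}/\ker A_k$ and $\Gamma^\wedge=\bigoplus_{k\ge0}\Gamma^{\wedge k}$ with product $\wedge$ ($\Gamma^{\wedge 0}=\mathcal A$). **$\sigma$-metric.** $g:\Gamma\otimes_{\mathcal A}\Gamma\to\mathcal A$ is a non-degenerate homomorphism of left-covariant $\mathcal A$-bimodules with $g\sigma=g$, $g_{12}\sigma^{\pm1}_{23}\sigma^{\pm1}_{12}=g_{23}$ on $\Gamma^{\otimes_{\mathcal A}3}$ (both signs), $g(\rho\otimes\rho')^*=g(\rho'^*\otimes\rho^*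 )$, and $g(S^2(\rho')\otimes\rho)=g(\rho\otimes\rho')$ for $\rho,\rho'\in\Gamma_L$. **Clifford algebra.** $\mathrm{Cl}(\Gamma,\sigma,g)=\Gamma^{\otimes}/\mathcal I$, where $\Gamma^\otimes=\bigoplus_k\Gamma^{\otimes_{\mathcal A}k}$ is the tensor algebra over $\mathcal A$ and $\mathcal I$ is the two-sided ideal generated by $\{\rho_2-g(\rho_2): \rho_2\in\Gamma^{\otimes_{\mathcal A}2},\ \sigma(\rho_2)=\rho_2\}$. **Contraction.** For $\omega\in\Gamma$: $\langle\!\langle\omega,a\rangle\!\rangle=0$ for $a\in\mathcal A$, and for $\rho\in\Gamma^{\otimes_{\mathcal A}l}$, $l\ge1$, $\langle\!\langle\omega,\rho\rangle\!\rangle=g_{12}(\omega\otimes B_{1,l-1}(\rho))$ with $B_{1,l-1}=\mathrm{id}-\sigma_{12}+\sigma_{12}\sigma_{23}-\dots+(-1)^{l-1}\sigma_{12}\sigma_{23}\cdots\sigma_{l-1,l}$. Since $A_l=(\mathrm{id}\otimes A_{l-1})B_{1,l-1}$, this induces a map $\Gamma\otimes_{\mathcal A}\Gamma^\wedge\to\Gamma^\wedge$. *)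

(* Defs.v *)
From HB Require Import structures.
From mathcomp Require fingroup.
From mathcomp Require Import all_boot all_order perm all_algebra complex zify.
From mathcomp Require Import boolp classical_sets reals.

Set Implicit Arguments.
Unset Strict Implicit.
Unset Printing Implicit Defensive.

Import Order.TTheory GRing.Theory Num.Theory.
Local Open Scope ring_scope.
Local Open Scope quotient_scope.

(* Abelian groups presented by generators and relations. A formal sum of
   generators is a list; [neg x] is the generator declared inverse to [x]. *)
Section PresentedGroup.
Variables (X : choiceType) (neg : X -> X) (rel : seq X -> seq X -> Prop).

Inductive pcong : seq X -> seq X -> Prop :=
| pcong_refl s : pcong s s
| pcong_sym s t : pcong s t -> pcong t s
| pcong_trans s t u : pcong s t -> pcong t u -> pcong s u
| pcong_cat s s' t t' : pcong s s' -> pcong t t' -> pcong (s ++ t) (s' ++ t')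
| pcong_comm s t : pcong (s ++ t) (t ++ s)
| pcong_neg x : pcong [:: x; neg x] [::]
| pcong_rel s t : rel s t -> pcong s t.

Definition pcongb (s t : seq X) : bool := `[< pcong s t >].

Lemma pcongb_refl : reflexive pcongb.
Proof. by move=> s; apply/asboolP/pcong_refl. Qed.
Lemma pcongb_sym : symmetric pcongb.
Proof. by move=> s t; apply/asboolP/asboolP; apply: pcong_sym. Qed.
Lemma pcongb_trans : transitive pcongb.
Proof.
by move=> t s u /asboolP st /asboolP tu; apply/asboolP; apply: pcong_trans st tu.
Qed.

Canonical pcongb_equiv := EquivRel pcongb pcongb_refl pcongb_sym pcongb_trans.

Definition pgrp := {eq_quot pcongb}.
HB.instance Definition _ := Choice.on pgrp.
HB.instance Definition _ := EqQuotient.on pgrp.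

Lemma pgrpP s t : reflect (pcong s t) (\pi_pgrp s == \pi_pgrp t).
Proof. by rewrite piE; apply: asboolP. Qed.

Lemma pgrp_eq s t : pcong s t -> \pi_pgrp s = \pi_pgrp t.
Proof. by move=> st; apply/eqP/pgrpP. Qed.

Lemma pgrp_repr s : pcong (repr (\pi_pgrp s)) s.
Proof. by apply/pgrpP; rewrite reprK. Qed.

Lemma pcong_negs s : pcong (s ++ map neg s) [::].
Proof.
elim: s => [|x s IH] /=; first exact: pcong_refl.
rewrite -cat1s -(cat1s (neg x)) catA.
apply: pcong_trans (pcong_cat (pcong_comm _ _) (pcong_refl _)) _.
rewrite -catA.
apply: (@pcong_trans _ (s ++ ([:: x; neg x] ++ map neg s))).
  by rewrite !catA /=; apply: pcong_refl.
apply: (@pcong_trans _ (s ++ ([::] ++ map neg s))); last by [].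
apply: pcong_cat (pcong_refl _) _.
exact: pcong_cat (pcong_neg x) (pcong_refl _).
Qed.

Lemma pcong_map s t : pcong s t -> pcong (map neg s) (map neg t).
Proof.
move=> st; have n u v : pcong u [::] -> pcong (v ++ u) v.
  by move=> h; rewrite -{2}(cats0 v); apply: pcong_cat (pcong_refl _) h.
apply: (@pcong_trans _ (map neg s ++ (t ++ map neg t))).
  exact/pcong_sym/n/pcong_negs.
rewrite catA; apply: (@pcong_trans _ ((s ++ map neg s) ++ map neg t)).
  apply: pcong_cat (pcong_refl _).
  apply: pcong_trans (pcong_comm _ _) _.
  exact: pcong_cat (pcong_sym st) (pcong_refl _).
apply: (@pcong_trans _ ([::] ++ map neg t)); last exact: pcong_refl.
exact: pcong_cat (pcong_negs _) (pcong_refl _).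
Qed.

Definition pzero : pgrp := \pi_pgrp [::].
Definition padd (u v : pgrp) : pgrp := \pi_pgrp (repr u ++ repr v).
Definition popp (u : pgrp) : pgrp := \pi_pgrp (map neg (repr u)).

Lemma paddE s t : padd (\pi_pgrp s) (\pi_pgrp t) = \pi_pgrp (s ++ t).
Proof. by apply: pgrp_eq; apply: pcong_cat; apply: pgrp_repr. Qed.

Lemma poppE s : popp (\pi_pgrp s) = \pi_pgrp (map neg s).
Proof. exact/pgrp_eq/pcong_map/pgrp_repr. Qed.

Lemma paddA : associative padd.
Proof.
move=> u v w; rewrite -[u]reprK -[v]reprK -[w]reprK.
by rewrite !paddE !reprK catA.
Qed.
Lemma paddC : commutative padd.
Proof.
move=> u v; rewrite -[u]reprK -[v]reprK !paddE.
exact/pgrp_eq/pcong_comm.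
Qed.
Lemma padd0 : left_id pzero padd.
Proof. by move=> u; rewrite -[u]reprK paddE. Qed.
Lemma paddN : left_inverse pzero popp padd.
Proof.
move=> u; rewrite -[u]reprK poppE paddC paddE.
exact/pgrp_eq/pcong_negs.
Qed.

HB.instance Definition _ := GRing.isZmodule.Build pgrp paddA paddC padd0 paddN.

Definition pgen (x : X) : pgrp := \pi_pgrp [:: x].

Lemma pgrp_piE s : \pi_pgrp s = \sum_(x <- s) pgen x.
Proof.
elim: s => [|x s IH]; first by rewrite big_nil.
by rewrite big_cons -IH /pgen -[RHS]/(padd _ _) paddE.
Qed.

Lemma pgrp_reprE (u : pgrp) : u = \sum_(x <- repr u) pgen x.
Proof. by rewrite -pgrp_piE reprK. Qed.

Lemma pgen_neg x : pgen (neg x) = - pgen x.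
Proof.
apply/eqP; rewrite -addr_eq0 addrC; apply/eqP.
rewrite -[LHS]/(padd _ _) paddE; exact/pgrp_eq/pcong_neg.
Qed.

Lemma pgen_rel s t : rel s t -> \sum_(x <- s) pgen x = \sum_(x <- t) pgen x.
Proof. by move=> st; rewrite -!pgrp_piE; apply/pgrp_eq/pcong_rel. Qed.

(* The additive map out of [pgrp] determined by its values on generators. *)
Definition plift (G : zmodType) (f : X -> G) (u : pgrp) : G :=
  \sum_(x <- repr u) f x.

Definition pcompat (G : zmodType) (f : X -> G) :=
  (forall x, f (neg x) = - f x) /\
  (forall s t, rel s t -> \sum_(x <- s) f x = \sum_(x <- t) f x).

Lemma plift_pi (G : zmodType) (f : X -> G) s :
  pcompat f -> plift f (\pi_pgrp s) = \sum_(x <- s) f x.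
Proof.
case=> fN fR; rewrite /plift.
suff H a b : pcong a b -> \sum_(x <- a) f x = \sum_(x <- b) f x.
  exact/H/pgrp_repr.
elim=> {a b} //.
- by move=> ? ? ? _ -> _ ->.
- by move=> ? ? ? ? _ e1 _ e2; rewrite !big_cat /= e1 e2.
- by move=> ? ?; rewrite !big_cat /= addrC.
- by move=> x; rewrite big_cons big_seq1 fN subrr big_nil.
Qed.

Lemma plift_gen (G : zmodType) (f : X -> G) x : pcompat f -> plift f (pgen x) = f x.
Proof. by move=> fc; rewrite plift_pi // big_seq1. Qed.

Lemma pliftD (G : zmodType) (f : X -> G) u v :
  pcompat f -> plift f (u + v) = plift f u + plift f v.
Proof.
by move=> fc; rewrite -[u + v]/(padd u v) plift_pi // big_cat.
Qed.

Lemma plift0 (G : zmodType) (f : X -> G) : pcompat f -> plift f 0 = 0.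
Proof. by move=> fc; apply: (@addrI _ (plift f 0)); rewrite -pliftD // !addr0. Qed.

Lemma pliftN (G : zmodType) (f : X -> G) u :
  pcompat f -> plift f (- u) = - plift f u.
Proof.
by move=> fc; apply/eqP; rewrite -addr_eq0 -pliftD // addNr plift0.
Qed.

Lemma plift_sum (G : zmodType) (f : X -> G) I (r : seq I) (u : I -> pgrp) :
  pcompat f -> plift f (\sum_(i <- r) u i) = \sum_(i <- r) plift f (u i).
Proof.
move=> fc; elim: r => [|i r IH]; first by rewrite !big_nil plift0.
by rewrite !big_cons pliftD // IH.
Qed.

Lemma pgrp_ind (P : pgrp -> Prop) :
  P 0 -> (forall x, P (pgen x)) -> (forall u v, P u -> P v -> P (u + v)) ->
  forall u, P u.
Proof.
by move=> P0 Pg PD u; rewrite [u]pgrp_reprE; apply: big_ind.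
Qed.

End PresentedGroup.

(* The tensor product over [S] of [M] (with right action [ra]) and [N] (with
   left action [la]). *)
Section Tensor.
Variables (S : Type) (M N : zmodType) (ra : M -> S -> M) (la : S -> N -> N).

Inductive tens_rel : seq (M * N) -> seq (M * N) -> Prop :=
| tens_addl m m' n : tens_rel [:: (m + m', n)] [:: (m, n); (m', n)]
| tens_addr m n n' : tens_rel [:: (m, n + n')] [:: (m, n); (m, n')]
| tens_bal m c n : tens_rel [:: (ra m c, n)] [:: (m, la c n)].

Definition tens_neg (p : M * N) : M * N := (- p.1, p.2).

Definition tens := pgrp tens_neg tens_rel.
HB.instance Definition _ := GRing.Zmodule.on tens.

Definition tprod (m : M) (n : N) : tens := pgen tens_neg tens_rel (m, n).

(* A list of pure tensors with sum [t]: Sweedler-type expressions are sums over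
   this list, and are independent of its choice when they are balanced. *)
Definition trep (t : tens) : seq (M * N) := repr t.

Definition tlift (G : zmodType) (f : M -> N -> G) (t : tens) : G :=
  \sum_(p <- trep t) f p.1 p.2.

Definition balanced (G : zmodType) (f : M -> N -> G) :=
  [/\ forall m m' n, f (m + m') n = f m n + f m' n,
      forall m n n', f m (n + n') = f m n + f m n' &
      forall m c n, f (ra m c) n = f m (la c n)].

Lemma trepE t : t = \sum_(p <- trep t) tprod p.1 p.2.
Proof. by rewrite {1}[t]pgrp_reprE; apply: eq_bigr => -[]. Qed.

Lemma tprodDl m m' n : tprod (m + m') n = tprod m n + tprod m' n.
Proof.
have := @pgen_rel _ tens_neg _ _ _ (tens_addl m m' n).
by rewrite !big_cons !big_nil !addr0.
Qed.

Lemma tprodDr m n n' : tprod m (n + n') = tprod m n + tprod m n'.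
Proof.
have := @pgen_rel _ tens_neg _ _ _ (tens_addr m n n').
by rewrite !big_cons !big_nil !addr0.
Qed.

Lemma tprodM m c n : tprod (ra m c) n = tprod m (la c n).
Proof.
have := @pgen_rel _ tens_neg _ _ _ (tens_bal m c n).
by rewrite !big_cons !big_nil !addr0.
Qed.

Lemma tprod_balanced : balanced tprod.
Proof. split; [exact: tprodDl|exact: tprodDr|exact: tprodM]. Qed.

Lemma balanced_compat (G : zmodType) (f : M -> N -> G) :
  balanced f -> pcompat tens_neg tens_rel (fun p => f p.1 p.2).
Proof.
case=> fl fr fb; split=> [[m n]|s t] /=.
  have f0 : f 0 n = 0 by apply: (@addrI _ (f 0 n)); rewrite -fl !addr0.
  by apply/eqP; rewrite -addr_eq0 -fl addNr f0.
by case=> *; rewrite !big_cons !big_nil !addr0 /= ?fl ?fr ?fb.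
Qed.

Lemma tlift_tprod (G : zmodType) (f : M -> N -> G) m n :
  balanced f -> tlift f (tprod m n) = f m n.
Proof. by move=> /balanced_compat fc; rewrite [LHS](plift_gen _ fc). Qed.

Lemma tliftD (G : zmodType) (f : M -> N -> G) t u :
  balanced f -> tlift f (t + u) = tlift f t + tlift f u.
Proof. by move=> /balanced_compat fc; apply: (pliftD _ _ fc). Qed.

Lemma tlift0 (G : zmodType) (f : M -> N -> G) : balanced f -> tlift f 0 = 0.
Proof. by move=> /balanced_compat fc; apply: (plift0 fc). Qed.

Lemma tens_ind (P : tens -> Prop) :
  P 0 -> (forall m n, P (tprod m n)) -> (forall t u, P t -> P u -> P (t + u)) ->
  forall t, P t.
Proof. by move=> P0 Pg; apply: pgrp_ind => // -[m n]; apply: Pg. Qed.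

End Tensor.


Section TensorLmodule.
Variables (K : nzRingType) (S : Type) (M : lmodType K) (N : zmodType).
Variables (ra : M -> S -> M) (la : S -> N -> N).
Hypothesis raZ : forall k m c, ra (k *: m) c = k *: ra m c.

Definition tscale (k : K) : tens ra la -> tens ra la :=
  tlift (fun m n => tprod ra la (k *: m) n).

Lemma tscale_balanced k : balanced ra la (fun m n => tprod ra la (k *: m) n).
Proof.
by split=> *; rewrite ?scalerDr -?raZ (tprodDl, tprodDr, tprodM).
Qed.

Lemma tscale_tprod k m n : tscale k (tprod ra la m n) = tprod ra la (k *: m) n.
Proof. exact/tlift_tprod/tscale_balanced. Qed.

Lemma tscaleDr k : {morph tscale k : t u / t + u}.
Proof. by move=> t u; apply/tliftD/tscale_balanced. Qed.

Lemma tscale0 k : tscale k 0 = 0.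
Proof. exact/tlift0/tscale_balanced. Qed.

Lemma tscaleA k l t : tscale k (tscale l t) = tscale (k * l) t.
Proof.
elim/tens_ind: t => [|m n|t u IHt IHu]; rewrite ?tscale0 ?tscale_tprod ?scalerA //.
by rewrite !tscaleDr IHt IHu.
Qed.

Lemma tscale1 : left_id 1 tscale.
Proof.
elim/tens_ind=> [|m n|t u IHt IHu]; rewrite ?tscale0 ?tscale_tprod ?scale1r //.
by rewrite tscaleDr IHt IHu.
Qed.

Lemma tscaleDl t : {morph tscale^~ t : k l / k + l}.
Proof.
move=> k l; elim/tens_ind: t => [|m n|t u IHt IHu].
- by rewrite !tscale0 addr0.
- by rewrite !tscale_tprod scalerDl tprodDl.
- by rewrite !tscaleDr IHt IHu addrACA.
Qed.

End TensorLmodule.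

(* Tensor product of vector spaces. *)
Section TensC.
Variables (C : fieldType) (V W : lmodType C).

Definition tensC := tens (fun (v : V) (c : C) => c *: v) (fun c (w : W) => c *: w).
HB.instance Definition _ := GRing.Zmodule.on tensC.

Lemma tensC_raZ (k : C) (v : V) (c : C) : c *: (k *: v) = k *: (c *: v).
Proof. by rewrite !scalerA mulrC. Qed.

HB.instance Definition _ := GRing.Zmodule_isLmodule.Build C tensC
  (tscaleA tensC_raZ) (tscale1 tensC_raZ) (tscaleDr tensC_raZ)
  (tscaleDl tensC_raZ).

Definition tC (v : V) (w : W) : tensC := tprod _ _ v w.
Definition repC (t : tensC) : seq (V * W) := trep t.

End TensC.

Notation "x ⊗ y" := (tC x y) (at level 40, left associativity).

(* Bimodules over an algebra [A], the scalars acting in the same way from the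
   left and from the right. *)
Record bimodule (C : fieldType) (A : algType C) := Bimodule {
  bim_sort :> lmodType A;
  ract : bim_sort -> A -> bim_sort;
  ractDl : forall x y a, ract (x + y) a = ract x a + ract y a;
  ractDr : forall x a b, ract x (a + b) = ract x a + ract x b;
  ractA : forall x a b, ract (ract x a) b = ract x (a * b);
  ract1 : forall x, ract x 1 = x;
  ractZ : forall a x b, ract (a *: x) b = a *: ract x b;
  ractC : forall x (c : C), ract x c%:A = c%:A *: x
}.

(* The vector space underlying an [A]-module. *)
Section RestrictScalars.
Variables (C : fieldType) (A : algType C) (M : lmodType A).

Definition restrC : Type := M.
HB.instance Definition _ := GRing.Zmodule.on restrC.

Definition restr_scale (c : C) (x : restrC) : restrC := (c%:A : A) *: (x : M).

Lemma restr_scaleA c d x : restr_scale c (restr_scale d x) = restr_scale (c * d) x.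
Proof. by rewrite /restr_scale scalerA -scalerAl mul1r scalerA. Qed.
Lemma restr_scale1 : left_id 1 restr_scale.
Proof. by move=> x; rewrite /restr_scale !scale1r. Qed.
Lemma restr_scaleDr : right_distributive restr_scale +%R.
Proof. by move=> c x y; rewrite /restr_scale scalerDr. Qed.
Lemma restr_scaleDl x : {morph restr_scale^~ x : c d / c + d}.
Proof. by move=> c d; rewrite /restr_scale !scalerDl. Qed.

HB.instance Definition _ := GRing.Zmodule_isLmodule.Build C restrC
  restr_scaleA restr_scale1 restr_scaleDr restr_scaleDl.

End RestrictScalars.

(* The bimodule [G ⊗_A G]. *)
Section TensA.
Variables (C : fieldType) (A : algType C) (G : bimodule A).

Definition tens2 := tens (@ract _ _ G) (fun a (x : G) => a *: x).
HB.instance Definition _ := GRing.Zmodule.on tens2.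
HB.instance Definition _ := GRing.Zmodule_isLmodule.Build A tens2
  (tscaleA (@ractZ _ _ G)) (tscale1 (@ractZ _ _ G)) (tscaleDr (@ractZ _ _ G))
  (tscaleDl (@ractZ _ _ G)).

Definition tA (x y : G) : tens2 := tprod _ _ x y.
Definition repA (t : tens2) : seq (G * G) := trep t.

Definition ract2 (t : tens2) (a : A) : tens2 :=
  \sum_(p <- repA t) tA p.1 (ract p.2 a).

Lemma tens2_ind (P : tens2 -> Prop) :
  P 0 -> (forall x y, P (tA x y)) -> (forall t u, P t -> P u -> P (t + u)) ->
  forall t, P t.
Proof. exact: tens_ind. Qed.

Lemma ract2_balanced a :
  balanced (@ract _ _ G) (fun b (x : G) => b *: x) (fun x y => tA x (ract y a)).
Proof.
by split=> *; rewrite /tA ?ractDl ?ractZ (tprodDl, tprodDr, tprodM).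
Qed.

Lemma ract2_tA x y a : ract2 (tA x y) a = tA x (ract y a).
Proof. exact: (tlift_tprod x y (ract2_balanced a)). Qed.

Lemma ract2D t u a : ract2 (t + u) a = ract2 t a + ract2 u a.
Proof. exact: (tliftD t u (ract2_balanced a)). Qed.

Lemma tens2_scale a x y : a *: tA x y = tA (a *: x) y.
Proof.
exact: (@tscale_tprod A A G G (@ract _ _ G) 
  (fun a (x : G) => a *: x) (@ractZ _ _ G) a x y).
Qed.

End TensA.

Notation "x ⊗A y" := (tA x y) (at level 40, left associativity).

(* The tensor algebra of [G] over [A]: the word [(a, [:: x1; ...; xk])] stands for
   [a x1 ⊗ ... ⊗ xk] in the k-th tensor power of [G], and for [a] in [A] if k = 0.
   The relations preserve the length of words, so this is the direct sum of the
   tensor powers. *)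
Section TensorAlgebra.
Variables (C : fieldType) (A : algType C) (G : bimodule A).
Implicit Types (a b c : A) (x y z : G) (s t : seq G).

Definition tword : choiceType := (A * seq G)%type.

Inductive talg_rel : seq tword -> seq tword -> Prop :=
| talg_addA a b s : talg_rel [:: (a + b, s)] [:: (a, s); (b, s)]
| talg_addG a s x y t :
    talg_rel [:: (a, s ++ (x + y) :: t)] [:: (a, s ++ x :: t); (a, s ++ y :: t)]
| talg_head a b x t : talg_rel [:: (a * b, x :: t)] [:: (a, (b *: x) :: t)]
| talg_bal a s x b y t :
    talg_rel [:: (a, s ++ (ract x b) :: y :: t)] [:: (a, s ++ x :: (b *: y) :: t)].

Definition talg_neg (p : tword) : tword := (- p.1, p.2).

Definition talg := pgrp talg_neg talg_rel.
HB.instance Definition _ := GRing.Zmodule.on talg.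

Definition tgen a s : talg := pgen talg_neg talg_rel (a, s).
Definition repT (u : talg) : seq tword := repr u.

Lemma repTE (u : talg) : u = \sum_(p <- repT u) tgen p.1 p.2.
Proof. by rewrite {1}[u]pgrp_reprE; apply: eq_bigr => -[]. Qed.

Lemma tgenDl a b s : tgen (a + b) s = tgen a s + tgen b s.
Proof.
have := @pgen_rel _ talg_neg _ _ _ (talg_addA a b s).
by rewrite !big_cons !big_nil !addr0.
Qed.

Lemma tgenDr a s x y t :
  tgen a (s ++ (x + y) :: t) = tgen a (s ++ x :: t) + tgen a (s ++ y :: t).
Proof.
have := @pgen_rel _ talg_neg _ _ _ (talg_addG a s x y t).
by rewrite !big_cons !big_nil !addr0.
Qed.

Lemma tgen_head a b x t : tgen (a * b) (x :: t) = tgen a (b *: x :: t).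
Proof.
have := @pgen_rel _ talg_neg _ _ _ (talg_head a b x t).
by rewrite !big_cons !big_nil !addr0.
Qed.

Lemma tgen_bal a s x b y t :
  tgen a (s ++ ract x b :: y :: t) = tgen a (s ++ x :: (b *: y) :: t).
Proof.
have := @pgen_rel _ talg_neg _ _ _ (talg_bal a s x b y t).
by rewrite !big_cons !big_nil !addr0.
Qed.

Lemma tgen0 s : tgen 0 s = 0.
Proof. by apply: (@addrI _ (tgen 0 s)); rewrite -tgenDl !addr0. Qed.

(* A family of maps out of the generators that factors through [talg]. *)
Definition talg_compat (V : zmodType) (f : A -> seq G -> V) :=
  [/\ forall a b s, f (a + b) s = f a s + f b s,
      forall a s x y t, f a (s ++ (x + y) :: t) = f a (s ++ x :: t) + f a (s ++ y :: t),
      forall a b x t, f (a * b) (x :: t) = f a (b *: x :: t) &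
      forall a s x b y t, f a (s ++ ract x b :: y :: t) = f a (s ++ x :: (b *: y) :: t)].

Lemma talg_pcompat (V : zmodType) (f : A -> seq G -> V) :
  talg_compat f -> pcompat talg_neg talg_rel (fun p => f p.1 p.2).
Proof.
case=> fA fG fh fb; split=> [[a s]|s t] /=.
  have f0 : f 0 s = 0 by apply: (@addrI _ (f 0 s)); rewrite -fA !addr0.
  by apply/eqP; rewrite -addr_eq0 -fA addNr f0.
by case=> *; rewrite !big_cons !big_nil !addr0 /= (fA, fG, fh, fb).
Qed.

Definition talg_lift (V : zmodType) (f : A -> seq G -> V) (u : talg) : V :=
  \sum_(p <- repT u) f p.1 p.2.

Lemma talg_lift_gen (V : zmodType) (f : A -> seq G -> V) a s :
  talg_compat f -> talg_lift f (tgen a s) = f a s.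
Proof. by move=> /talg_pcompat fc; rewrite [LHS](plift_gen _ fc). Qed.

Lemma talg_liftD (V : zmodType) (f : A -> seq G -> V) :
  talg_compat f -> {morph talg_lift f : u v / u + v}.
Proof. by move=> /talg_pcompat fc u v; apply: (pliftD _ _ fc). Qed.

Lemma talg_lift0 (V : zmodType) (f : A -> seq G -> V) :
  talg_compat f -> talg_lift f 0 = 0.
Proof. by move=> /talg_pcompat fc; apply: (plift0 fc). Qed.

Lemma talg_liftN (V : zmodType) (f : A -> seq G -> V) :
  talg_compat f -> {morph talg_lift f : u / - u}.
Proof. by move=> /talg_pcompat fc u; apply: (pliftN _ fc). Qed.

Lemma talg_ind (P : talg -> Prop) :
  P 0 -> (forall a s, P (tgen a s)) -> (forall u v, P u -> P v -> P (u + v)) ->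
  forall u, P u.
Proof. by move=> P0 Pg; apply: pgrp_ind => // -[a s]; apply: Pg. Qed.

Lemma talg_eqP (V : zmodType) (f g : talg -> V) :
  {morph f : u v / u + v} -> {morph g : u v / u + v} ->
  (forall a s, f (tgen a s) = g (tgen a s)) -> f =1 g.
Proof.
move=> fD gD fg; elim/talg_ind => [|//|u v IHu IHv]; last by rewrite fD gD IHu IHv.
have z (h : talg -> V) : {morph h : u v / u + v} -> h 0 = 0.
  by move=> hD; apply: (@addrI _ (h 0)); rewrite -hD !addr0.
by rewrite !z.
Qed.

(* Words times a coefficient on the right. *)
Fixpoint wract (s : seq G) (c : A) : seq G :=
  match s with
  | [::] => [::]
  | [:: x] => [:: ract x c]
  | x :: s' => x :: wract s' c
  end.

Definition wcoef a s c := if s is [::] then a * c else a.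

Definition wmul (p q : tword) : tword :=
  (wcoef p.1 p.2 q.1, wract p.2 q.1 ++ q.2).

Lemma wract_cat s x t c : wract (s ++ x :: t) c = s ++ wract (x :: t) c.
Proof.
elim: s => // y s IH; rewrite !cat_cons -IH.
by case: s {IH}.
Qed.

Lemma wract_rcons s x c : wract (rcons s x) c = rcons s (ract x c).
Proof. by rewrite -!cats1 wract_cat. Qed.

Lemma wractA s b c : wract (wract s b) c = wract s (b * c).
Proof. by case/lastP: s => // s x; rewrite !wract_rcons ractA. Qed.

Lemma wract1 s : wract s 1 = s.
Proof. by case/lastP: s => // s x; rewrite wract_rcons ract1. Qed.

Lemma wmul_nil a b t : wmul (a, [::]) (b, t) = (a * b, t).
Proof. by []. Qed.

Lemma wmul_rcons a s x b t : wmul (a, rcons s x) (b, t) = (a, s ++ ract x b :: t).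
Proof. by rewrite /wmul /= wract_rcons cat_rcons; case: s. Qed.

Lemma wmulA : associative wmul.
Proof.
move=> [a s] [b t] [c u]; case/lastP: s => [|s x].
  case/lastP: t => [|t y]; first by rewrite !wmul_nil mulrA.
  by rewrite wmul_rcons !wmul_nil wmul_rcons.
case/lastP: t => [|t y].
  by rewrite wmul_nil !wmul_rcons cats1 wmul_rcons ractA.
rewrite (wmul_rcons b) (wmul_rcons a s x b (rcons t y)) -rcons_cons -rcons_cat.
by rewrite !wmul_rcons -catA.
Qed.

Definition tmul (u v : talg) : talg :=
  talg_lift (fun a s => talg_lift (fun b t =>
    let p := wmul (a, s) (b, t) in tgen p.1 p.2) v) u.

Lemma wmul_compatr a s :
  talg_compat (fun b t => let p := wmul (a, s) (b, t) in tgen p.1 p.2).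
Proof.
case/lastP: s => [|s z]; split=> ? ? ? *; rewrite !(wmul_nil, wmul_rcons) /=.
- by rewrite mulrDr tgenDl.
- by rewrite tgenDr.
- by rewrite mulrA tgen_head.
- by rewrite tgen_bal.
- by rewrite ractDr tgenDr.
- by rewrite -!cat_cons !catA tgenDr.
- by rewrite -ractA tgen_bal.
- by rewrite -!cat_cons !catA tgen_bal.
Qed.

Lemma wmul_compatl (v : talg) :
  talg_compat (fun a s => talg_lift (fun b t =>
    let p := wmul (a, s) (b, t) in tgen p.1 p.2) v).
Proof.
have key a s := wmul_compatr a s.
split=> [a b s|a s x y t|a b x t|a s x b y t].
all: elim/talg_ind: v => [|c u|v w IHv IHw].
all: rewrite ?(talg_lift0 (key _ _)) ?(talg_lift_gen _ _ (key _ _)) ?addr0 //.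
all: try by rewrite !(talg_liftD (key _ _)) ?IHv ?IHw // addrACA.
- case/lastP: s => [|s x]; rewrite !(wmul_nil, wmul_rcons) /=.
    by rewrite mulrDl tgenDl.
  by rewrite tgenDl.
- case/lastP: t => [|t z].
    by rewrite !cats1 !wmul_rcons /= ractDl tgenDr.
  by rewrite -!rcons_cons -!rcons_cat !wmul_rcons /= -!catA /= tgenDr.
- case/lastP: t => [|t z].
    rewrite -[[:: x]]/(rcons [::] x) -[[:: b *: x]]/(rcons [::] (b *: x)).
    by rewrite !wmul_rcons /= ractZ tgen_head.
  by rewrite -!rcons_cons !wmul_rcons /= tgen_head.
- case/lastP: t => [|t z].
    rewrite -!(cat_rcons _ s) !cats1 !wmul_rcons /= ractZ !cat_rcons.
    by rewrite tgen_bal.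
  by rewrite -!rcons_cons -!rcons_cat !wmul_rcons /= -!catA /= tgen_bal.
Qed.

Lemma tmulDl : left_distributive tmul +%R.
Proof. by move=> u v w; apply: (talg_liftD (wmul_compatl w)). Qed.

Lemma tmulDr : right_distributive tmul +%R.
Proof.
move=> u v w; rewrite /tmul /talg_lift -big_split /=; apply: eq_bigr => p _.
exact: (talg_liftD (wmul_compatr _ _)).
Qed.

Lemma tmul_gen a s b t :
  tmul (tgen a s) (tgen b t) = tgen (wcoef a s b) (wract s b ++ t).
Proof.
rewrite /tmul (talg_lift_gen _ _ (wmul_compatl _)).
exact: (talg_lift_gen _ _ (wmul_compatr _ _)).
Qed.

Definition tone : talg := tgen 1 [::].

Lemma tmulA : associative tmul.
Proof.
move=> u v w; elim/talg_ind: u => [|a s|u u' IH IH'].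
- have z (k : talg) : tmul 0 k = 0 by apply: (@addrI _ (tmul 0 k)); rewrite -tmulDl !addr0.
  by rewrite !z.
- elim/talg_ind: v => [|b t|v v' IH IH'].
  + have z (k : talg) : tmul 0 k = 0 by apply: (@addrI _ (tmul 0 k)); rewrite -tmulDl !addr0.
    have z' (k : talg) : tmul k 0 = 0 by apply: (@addrI _ (tmul k 0)); rewrite -tmulDr !addr0.
    by rewrite z z' z.
  + elim/talg_ind: w => [|c r|w w' IH IH'].
    * have z' (k : talg) : tmul k 0 = 0 by apply: (@addrI _ (tmul k 0)); rewrite -tmulDr !addr0.
      by rewrite !z'.
    * by rewrite !tmul_gen; case: (wmulA (a, s) (b, t) (c, r)) => /= -> ->.
    * by rewrite !tmulDr IH IH'.
  + by rewrite !(tmulDl, tmulDr) IH IH'.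
- by rewrite !tmulDl IH IH'.
Qed.

Lemma tmul1 : left_id tone tmul.
Proof.
elim/talg_ind => [|b t|u v IHu IHv]; last by rewrite tmulDr IHu IHv.
  by apply: (@addrI _ (tmul tone 0)); rewrite -tmulDr !addr0.
by rewrite tmul_gen /= mul1r.
Qed.

Lemma tmulr1 : right_id tone tmul.
Proof.
elim/talg_ind => [|b t|u v IHu IHv]; last by rewrite tmulDl IHu IHv.
  by apply: (@addrI _ (tmul 0 tone)); rewrite -tmulDl !addr0.
by rewrite tmul_gen /= wract1 cats0; case: t => //=; rewrite mulr1.
Qed.

Lemma tone_neq0 : tone != 0.
Proof.
pose f a s : A := if s is [::] then a else 0.
have fc : talg_compat f.
  by split=> [a b [|x s]|a [|z s] x y t|a b x t|a [|z s] x b y t] //=; rewrite addr0.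
apply/eqP => /(congr1 (talg_lift f)).
by rewrite (talg_lift0 fc) (talg_lift_gen _ _ fc) /= => /eqP; rewrite oner_eq0.
Qed.

HB.instance Definition _ := GRing.Zmodule_isNzRing.Build talg
  tmulA tmul1 tmulr1 tmulDl tmulDr tone_neq0.

Definition temb (a : A) : talg := tgen a [::].
Definition tinj (x : G) : talg := tgen 1 [:: x].

Lemma tgenM a s b t :
  tgen a s * tgen b t = tgen (wcoef a s b) (wract s b ++ t).
Proof. exact: tmul_gen. Qed.

Lemma tembM : {morph temb : a b / a * b}.
Proof. by move=> a b; rewrite tgenM. Qed.
Lemma tembD : {morph temb : a b / a + b}.
Proof. by move=> a b; rewrite /temb tgenDl. Qed.
Lemma temb1 : temb 1 = 1. Proof. by []. Qed.

Lemma tgenE a s : tgen a s = temb a * \prod_(x <- s) tinj x.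
Proof.
suff -> : \prod_(x <- s) tinj x = tgen 1 s by rewrite tgenM /= mulr1.
elim: s => [|x s IH]; first by rewrite big_nil.
by rewrite big_cons IH tgenM /= ract1.
Qed.

Lemma tinjD : {morph tinj : x y / x + y}.
Proof. by move=> x y; apply: (tgenDr 1 [::] x y [::]). Qed.
Lemma tinjZ a x : tinj (a *: x) = temb a * tinj x.
Proof. by rewrite /tinj /temb tgenM /= mulr1 -tgen_head mul1r. Qed.
Lemma tinjR x a : tinj (ract x a) = tinj x * temb a.
Proof. by rewrite tgenM. Qed.

Definition talg_scale (a : A) (u : talg) : talg := temb a * u.

Lemma talg_scaleA a b u : talg_scale a (talg_scale b u) = talg_scale (a * b) u.
Proof. by rewrite /talg_scale tembM mulrA. Qed.
Lemma talg_scale1 : left_id 1 talg_scale.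
Proof. by move=> u; rewrite /talg_scale temb1 mul1r. Qed.
Lemma talg_scaleDr : right_distributive talg_scale +%R.
Proof. by move=> a u v; rewrite /talg_scale mulrDr. Qed.
Lemma talg_scaleDl u : {morph talg_scale^~ u : a b / a + b}.
Proof. by move=> a b; rewrite /talg_scale tembD mulrDl. Qed.

HB.instance Definition _ := GRing.Zmodule_isLmodule.Build A talg
  talg_scaleA talg_scale1 talg_scaleDr talg_scaleDl.

(* The component of degree k, and the elements of the k-th tensor power. *)
Definition hproj (k : nat) (u : talg) : talg :=
  talg_lift (fun a s => if size s == k then tgen a s else 0) u.

Definition homog (k : nat) (u : talg) : Prop := hproj k u = u.

Lemma hproj_compat k : talg_compat (fun a s => if size s == k then tgen a s else 0).
Proof.
split=> [a b s|a s x y t|a b x t|a s x b y t]; rewrite ?size_cat /=.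
- by case: ifP => _; rewrite ?addr0 ?tgenDl.
- by case: ifP => _; rewrite ?addr0 ?tgenDr.
- by rewrite tgen_head.
- by rewrite tgen_bal.
Qed.

Lemma hproj_gen k a s : hproj k (tgen a s) = if size s == k then tgen a s else 0.
Proof. exact: (talg_lift_gen _ _ (hproj_compat k)). Qed.

Lemma hprojD k : {morph hproj k : u v / u + v}.
Proof. exact: (talg_liftD (hproj_compat k)). Qed.

Lemma hprojN k : {morph hproj k : u / - u}.
Proof. exact: (talg_liftN (hproj_compat k)). Qed.

Lemma hproj0 k : hproj k 0 = 0.
Proof. exact: (talg_lift0 (hproj_compat k)). Qed.

Lemma hprojZ k a u : hproj k (a *: u) = a *: hproj k u.
Proof.
elim/talg_ind: u => [|b s|u v IHu IHv].
- by rewrite scaler0 hproj0 scaler0.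
- have e c : a *: tgen c s = tgen (a * c) s by rewrite [LHS]tgenM.
  by rewrite e !hproj_gen; case: ifP => _; rewrite ?scaler0 ?e.
- by rewrite scalerDr !hprojD IHu IHv scalerDr.
Qed.

(* A bound on the degrees of the nonzero components. *)
Definition tdeg (u : talg) : nat := \max_(p <- repT u) size p.2.

Lemma hproj_gt_tdeg k u : (tdeg u < k)%N -> hproj k u = 0.
Proof.
move=> ltk; rewrite /hproj /talg_lift big_seq big1 // => p pu.
case: eqP => // e; move: ltk; rewrite ltnNge -e.
by case/negP; exact: (@leq_bigmax_seq _ (repT u) xpredT (fun p : tword => size p.2)).
Qed.

Lemma hproj_sum u : u = \sum_(k < (tdeg u).+1) hproj k u.
Proof.
rewrite exchange_big /= {1}[u]repTE big_seq [RHS]big_seq.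
apply: eq_bigr => p pu.
have lt : (size p.2 < (tdeg u).+1)%N.
  rewrite ltnS; exact: (@leq_bigmax_seq _ (repT u) xpredT (fun p : tword => size p.2)).
rewrite (bigD1 (Ordinal lt)) //= eqxx big1 ?addr0 // => i ne.
by case: eqP => // e; case/eqP: ne; apply: val_inj.
Qed.

Definition tmul2 (t : tens2 G) : talg := \sum_(p <- repA t) tinj p.1 * tinj p.2.

Lemma tmul2_balanced :
  balanced (@ract _ _ G) (fun b (x : G) => b *: x) (fun x y => tinj x * tinj y).
Proof. by split=> *; rewrite ?tinjD ?mulrDl ?mulrDr // tinjR tinjZ mulrA. Qed.

Lemma tmul2_tA x y : tmul2 (x ⊗A y) = tinj x * tinj y.
Proof. exact: (tlift_tprod x y tmul2_balanced). Qed.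

Lemma tmul2D : {morph tmul2 : t u / t + u}.
Proof. by move=> t u; apply: (tliftD t u tmul2_balanced). Qed.

(* [tmul2] identifies [G ⊗_A G] with the component of degree 2. *)
Definition to_tens2 (u : talg) : tens2 G :=
  talg_lift (fun a s => if s is [:: x; y] then a *: (x ⊗A y) else 0) u.

Lemma to_tens2_compat :
  talg_compat (fun a s => if s is [:: x; y] then a *: (x ⊗A y) else 0).
Proof.
split.
- by move=> a b [|x [|y [|z s]]] //=; rewrite ?addr0 // scalerDl.
- move=> a [|v [|w [|v' s]]] x y [|z [|z' t]] //=; rewrite ?addr0 // -scalerDr.
  + by congr (_ *: _); apply: tprodDl.
  + by congr (_ *: _); apply: tprodDr.
- by move=> a b x [|y [|z t]] //=; rewrite -scalerA tens2_scale.
- move=> a [|v [|w [|v' s]]] x b y [|z t] //=.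
  by congr (_ *: _); apply: tprodM.
Qed.

Lemma tmul2K : cancel tmul2 to_tens2.
Proof.
elim/tens2_ind=> [|x y|t u IHt IHu].
- rewrite [tmul2 0](tlift0 tmul2_balanced); exact: (talg_lift0 to_tens2_compat).
- by rewrite tmul2_tA tgenM /= ract1 [LHS](talg_lift_gen _ _ to_tens2_compat) scale1r.
- by rewrite tmul2D -[RHS](congr2 +%R IHt IHu); apply: (talg_liftD to_tens2_compat).
Qed.

Lemma to_tens2K u : homog 2 u -> tmul2 (to_tens2 u) = u.
Proof.
have D : {morph (fun v => tmul2 (to_tens2 v)) : v w / v + w}.
  by move=> v w /=; rewrite -tmul2D; congr tmul2; apply: (talg_liftD to_tens2_compat).
move=> {2}<-; move: u; apply: talg_eqP D (hprojD 2) _ => a s.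
rewrite hproj_gen [to_tens2 _](talg_lift_gen _ _ to_tens2_compat).
case: s => [|x [|y [|z s]]] /=; try exact: (tlift0 tmul2_balanced).
by rewrite tens2_scale tmul2_tA tinjZ -mulrA !tgenM /= ract1 !mulr1.
Qed.

(* [place i f (a x1 ⊗ ... ⊗ xk)] is
   [a x1 ⊗ ... ⊗ xi ⊗ f (x(i+1) ⊗ x(i+2)) ⊗ x(i+3) ⊗ ... ⊗ xk], and 0 when
   [k < i + 2]. *)
Section Place.
Variable f : tens2 G -> talg.

Fixpoint wplace (i : nat) (s : seq G) : talg :=
  match i, s with
  | 0, x :: y :: s' => f (x ⊗A y) * tgen 1 s'
  | i'.+1, x :: s' => tinj x * wplace i' s'
  | _, _ => 0
  end.

Definition place (i : nat) (u : talg) : talg :=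
  talg_lift (fun a s => temb a * wplace i s) u.

Hypothesis fD : {morph f : t u / t + u}.
Hypothesis fZ : forall a (w : tens2 G), f (a *: w) = temb a * f w.
Hypothesis fR : forall (w : tens2 G) a, f (ract2 w a) = f w * temb a.

Lemma tAD x x' y : (x + x') ⊗A y = x ⊗A y + x' ⊗A y.
Proof. exact: tprodDl. Qed.
Lemma tADr x y y' : x ⊗A (y + y') = x ⊗A y + x ⊗A y'.
Proof. exact: tprodDr. Qed.
Lemma tAM x a y : ract x a ⊗A y = x ⊗A (a *: y).
Proof. exact: tprodM. Qed.

Lemma wplaceD i s x y t :
  wplace i (s ++ (x + y) :: t) = wplace i (s ++ x :: t) + wplace i (s ++ y :: t).
Proof.
elim: s i => [|z s IH] [|i] /=.
- by case: t => [|w t]; rewrite ?addr0 // tAD fD mulrDl.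
- by rewrite tinjD mulrDl.
- case: s {IH} => [|w s] /=; first by rewrite tADr fD mulrDl.
  by rewrite tgenDr mulrDr.
- by rewrite IH mulrDr.
Qed.

Lemma wplaceZ i a x t : wplace i (a *: x :: t) = temb a * wplace i (x :: t).
Proof.
case: i => [|i] /=; last by rewrite tinjZ mulrA.
by case: t => [|y t]; rewrite ?mulr0 // -tens2_scale fZ mulrA.
Qed.

Lemma tembgen b s : temb b * tgen 1 s = tgen b s.
Proof. by rewrite tgenM /= mulr1. Qed.

Lemma wplace_bal i s x b y t :
  wplace i (s ++ ract x b :: y :: t) = wplace i (s ++ x :: (b *: y) :: t).
Proof.
elim: s i => [|z s IH] [|i] //=.
- by rewrite tAM.
- by rewrite tinjR -mulrA -wplaceZ.
- case: s {IH} => [|w s] /=; last by rewrite tgen_bal.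
  rewrite -ract2_tA fR -mulrA tembgen.
  by rewrite -tgen_head mul1r.
- by rewrite IH.
Qed.

Lemma place_compat i : talg_compat (fun a s => temb a * wplace i s).
Proof.
split=> [a b s|a s x y t|a b x t|a s x b y t].
- by rewrite tembD mulrDl.
- by rewrite wplaceD mulrDr.
- by rewrite wplaceZ mulrA tembM.
- by rewrite wplace_bal.
Qed.

Lemma place_gen i a s : place i (tgen a s) = temb a * wplace i s.
Proof. exact: (talg_lift_gen _ _ (place_compat i)). Qed.

Lemma placeD i : {morph place i : u v / u + v}.
Proof. exact: (talg_liftD (place_compat i)). Qed.

Lemma placeN i : {morph place i : u / - u}.
Proof. exact: (talg_liftN (place_compat i)). Qed.

Lemma place0 i : place i 0 = 0.
Proof. exact: (talg_lift0 (place_compat i)). Qed.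

Lemma placeZ i a u : place i (a *: u) = a *: place i u.
Proof.
elim/talg_ind: u => [|b s|u v IHu IHv].
- by rewrite scaler0 place0 scaler0.
- have -> : a *: tgen b s = tgen (a * b) s by rewrite [LHS]tgenM.
  by rewrite !place_gen tembM -mulrA.
- by rewrite scalerDr !placeD IHu IHv scalerDr.
Qed.

Lemma place_cat s (w : tens2 G) t :
  place (size s) (tgen 1 s * tmul2 w * tgen 1 t) = tgen 1 s * f w * tgen 1 t.
Proof.
elim/tens_ind: w => [|x y|v w IHv IHw].
- rewrite /tmul2 [\sum_(p <- _) _](tlift0 tmul2_balanced).
  have -> : f 0 = 0 by apply: (@addrI _ (f 0)); rewrite -fD !addr0.
  by rewrite !(mulr0, mul0r) place0.
- rewrite tmul2_tA !tgenE temb1 !mul1r mulrA.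
  have -> : (\prod_(x <- s) tinj x) * tinj x * tinj y * (\prod_(x <- t) tinj x)
      = tgen 1 (s ++ x :: y :: t).
    by rewrite tgenE temb1 mul1r big_cat !big_cons /= !mulrA.
  rewrite place_gen temb1 mul1r; elim: s => [|z s IH] /=.
    by rewrite big_nil mul1r tgenE temb1 mul1r.
  by rewrite IH big_cons !mulrA.
- by rewrite tmul2D fD !(mulrDl, mulrDr) placeD IHv IHw.
Qed.

End Place.

End TensorAlgebra.

(* Hopf *-algebras; [sw a] is a list of pairs (a_(1), a_(2)). *)
Record hopf_star (C : numClosedFieldType) (A : algType C) := HopfStar {
  cop : A -> tensC A A;
  eps : A -> C;
  antipode : A -> A;
  star : A -> A;
  sw (a : A) := repC (cop a);
  cop_linear : forall c a b, cop (c *: a + b) = c *: cop a + cop b;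
  cop1 : cop 1 = 1 ⊗ 1;
  copM : forall a b, cop (a * b) =
    \sum_(p <- sw a) \sum_(q <- sw b) (p.1 * q.1) ⊗ (p.2 * q.2);
  eps_linear : forall c a b, eps (c *: a + b) = c * eps a + eps b;
  eps1 : eps 1 = 1;
  epsM : forall a b, eps (a * b) = eps a * eps b;
  copA : forall a,
    \sum_(p <- sw a) \sum_(q <- sw p.1) q.1 ⊗ (q.2 ⊗ p.2) =
    \sum_(p <- sw a) \sum_(q <- sw p.2) p.1 ⊗ (q.1 ⊗ q.2);
  counitl : forall a, \sum_(p <- sw a) eps p.1 *: p.2 = a;
  counitr : forall a, \sum_(p <- sw a) eps p.2 *: p.1 = a;
  antipode_linear : forall c a b, antipode (c *: a + b) = c *: antipode a + antipode b;
  antipodel : forall a, \sum_(p <- sw a) antipode p.1 * p.2 = (eps a)%:A;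
  antipoder : forall a, \sum_(p <- sw a) p.1 * antipode p.2 = (eps a)%:A;
  star_antilinear : forall c a b, star (c *: a + b) = c^* *: star a + star b;
  starM : forall a b, star (a * b) = star b * star a;
  starK : involutive star;
  cop_star : forall a, cop (star a) = \sum_(p <- sw a) star p.1 ⊗ star p.2
}.

Section Cosemisimple.
Variables (C : numClosedFieldType) (A : algType C) (H : hopf_star A).
Local Open Scope classical_set_scope.

Section Corepresentation.
Variables (V : lmodType C) (delta : V -> tensC V A).

Definition corepresentation : Prop :=
  [/\ forall c v w, delta (c *: v + w) = c *: delta v + delta w,
      forall v,
        \sum_(p <- repC (delta v)) \sum_(q <- repC (delta p.1)) q.1 ⊗ (q.2 ⊗ p.2) =
        \sum_(p <- repC (delta v)) \sum_(q <- sw H p.2) p.1 ⊗ (q.1 ⊗ q.2) &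
      forall v, \sum_(p <- repC (delta v)) eps H p.2 *: p.1 = v].

Definition subcorep (W : set V) : Prop :=
  [/\ W 0, forall c v w, W v -> W w -> W (c *: v + w) &
      forall v, W v -> exists2 s : seq (V * A),
        (forall p, p \in s -> W p.1) & delta v = \sum_(p <- s) p.1 ⊗ p.2].

Definition simple_subcorep (W : set V) : Prop :=
  [/\ subcorep W, W <> [set 0] &
      forall U, subcorep U -> U `<=` W -> U = [set 0] \/ U = W].

(* [V] is the internal direct sum of the subspaces [W i]. *)
Definition direct_sum (I : choiceType) (W : I -> set V) : Prop :=
  (forall v, exists (r : seq I) (w : I -> V),
     (forall i, W i (w i)) /\ v = \sum_(i <- r) w i) /\
  (forall (r : seq I) (w : I -> V), uniq r -> (forall i, W i (w i)) ->
     \sum_(i <- r) w i = 0 -> forall i, i \in r -> w i = 0).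

End Corepresentation.

Definition cosemisimple : Prop :=
  forall (V : lmodType C) (delta : V -> tensC V A), corepresentation delta ->
  exists (I : choiceType) (W : I -> set V),
    (forall i, simple_subcorep delta (W i)) /\ direct_sum W.

(* The dual [A°]: functionals f with f(ab) = f_(1)(a) f_(2)(b). *)
Definition linear_functional (f : A -> C) : Prop :=
  forall c a b, f (c *: a + b) = c * f a + f b.

Definition finite_dual (f : A -> C) : Prop :=
  linear_functional f /\
  exists2 s : seq ((A -> C) * (A -> C)),
    (forall p, p \in s -> linear_functional p.1 /\ linear_functional p.2) &
    forall a b, f (a * b) = \sum_(p <- s) p.1 a * p.2 b.

End Cosemisimple.

(* Finite dimensional left-covariant first order differential *-calculi with
   S^2-invariant quantum tangent space, [n] being the dimension. *)
Record calculus (C : numClosedFieldType) (A : algType C) (H : hopf_star A)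
    (n : nat) := Calculus {
  Gamma : bimodule A;
  diff : A -> Gamma;
  coact : Gamma -> tensC A (restrC Gamma);
  fstar : Gamma -> Gamma;
  theta : 'I_n -> Gamma;
  tang : 'I_n -> A -> C;
  tangS2 : 'M[C]_n;
  S2 : Gamma -> Gamma;
  diff_linear : forall c a b, diff (c *: a + b) = c%:A *: diff a + diff b;
  diffM : forall a b, diff (a * b) = ract (diff a) b + a *: diff b;
  diff_span : forall x, exists s : seq (A * A), x = \sum_(p <- s) p.1 *: diff p.2;
  coact_linear : forall c x y, coact (c%:A *: x + y) = c *: coact x + coact y;
  coactA : forall x,
    \sum_(p <- repC (coact x)) \sum_(q <- sw H p.1) q.1 ⊗ (q.2 ⊗ p.2) =
    \sum_(p <- repC (coact x)) \sum_(q <- repC (coact p.2)) p.1 ⊗ (q.1 ⊗ q.2);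
  coact_counit : forall x, \sum_(p <- repC (coact x)) (eps H p.1)%:A *: p.2 = x :> Gamma;
  coactl : forall a x, coact (a *: x) =
    \sum_(p <- sw H a) \sum_(q <- repC (coact x)) (p.1 * q.1) ⊗ (p.2 *: (q.2 : Gamma) : restrC Gamma);
  coactr : forall x a, coact (ract x a) =
    \sum_(q <- repC (coact x)) \sum_(p <- sw H a) (q.1 * p.1) ⊗ (ract (q.2 : Gamma) p.2 : restrC Gamma);
  coact_diff : forall a, coact (diff a) = \sum_(p <- sw H a) p.1 ⊗ (diff p.2 : restrC Gamma);
  fstar_antilinear : forall c x y, fstar (c%:A *: x + y) = c^*%:A *: fstar x + fstar y;
  fstarK : involutive fstar;
  fstarl : forall a x, fstar (a *: x) = ract (fstar x) (star H a);
  fstarr : forall x a, fstar (ract x a) = star H a *: fstar x;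
  fstar_diff : forall a, fstar (diff a) = diff (star H a);
  left_inv (x : Gamma) : Prop := coact x = 1 ⊗ (x : restrC Gamma);
  theta_inv : forall i, left_inv (theta i);
  theta_span : forall x, left_inv x ->
    exists c : 'I_n -> C, x = \sum_i (c i)%:A *: theta i;
  theta_free : forall c : 'I_n -> C, \sum_i (c i)%:A *: theta i = 0 -> forall i, c i = 0;
  tang_dual : forall i, finite_dual (tang i);
  tang_free : forall c : 'I_n -> C,
    (forall a, \sum_i c i * tang i a = 0) -> forall i, c i = 0;
  diffE : forall a, diff a = \sum_(p <- sw H a) \sum_i (tang i p.2 *: p.1) *: theta i;
  tang_space : set (A -> C) :=
    [set X | exists c : 'I_n -> C, X = fun a => \sum_i c i * tang i a]%classic;
  tang_S2_inv :
    [set (fun a => X (antipode H (antipode H a))) | X in tang_space]%classic = tang_space;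
  tangS2E : forall i a,
    tang i (antipode H (antipode H a)) = \sum_j tangS2 i j * tang j a;
  S2D : {morph S2 : x y / x + y};
  S2_theta : forall i, S2 (theta i) = \sum_j (tangS2 j i)%:A *: theta j;
  S2Z : forall a x, S2 (a *: x) = antipode H (antipode H a) *: S2 x
}.

Section CalculusDefs.
Variables (C : numClosedFieldType) (A : algType C) (H : hopf_star A) (n : nat).
Variable Gam : calculus H n.
Local Notation G := (Gamma Gam).

Definition omega (a : A) : G := \sum_(p <- sw H a) antipode H p.1 *: diff Gam p.2.

Definition calc_ideal (a : A) : Prop := omega a = 0 /\ eps H a = 0.

(* On [G ⊗_A G]: the left coaction, the map S^2 ⊗ S^2 and the involution. The
   sign convention in the last one affects no condition below. *)
Definition coact2 (t : tens2 G) : tensC A (restrC (tens2 G)) :=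
  \sum_(p <- repA t) \sum_(u <- repC (coact p.1)) \sum_(v <- repC (coact p.2))
    (u.1 * v.1) ⊗ ((u.2 : G) ⊗A (v.2 : G) : restrC (tens2 G)).

Definition S2_2 (t : tens2 G) : tens2 G := \sum_(p <- repA t) S2 p.1 ⊗A S2 p.2.

Definition fstar2 (t : tens2 G) : tens2 G := \sum_(p <- repA t) fstar p.2 ⊗A fstar p.1.

(* [f_(i+1,i+2)] on tensor powers, for f : G ⊗_A G -> G ⊗_A G resp. to A. *)
Definition leg2 (f : tens2 G -> tens2 G) (i : nat) : talg G -> talg G :=
  place (fun t => tmul2 (f t)) i.
Definition leg0 (f : tens2 G -> A) (i : nat) : talg G -> talg G :=
  place (fun t => temb G (f t)) i.

Record braiding := Braiding {
  sigma : tens2 G -> tens2 G;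
  sigmaV : tens2 G -> tens2 G;
  sigmaK : cancel sigma sigmaV;
  sigmaVK : cancel sigmaV sigma;
  sigmaD : {morph sigma : t u / t + u};
  sigmaZ : forall a (t : tens2 G), sigma (a *: t) = a *: sigma t;
  sigmaR : forall (t : tens2 G) a, sigma (ract2 t a) = ract2 (sigma t) a;
  sigma_coact : forall t, coact2 (sigma t) =
    \sum_(p <- repC (coact2 t)) p.1 ⊗ (sigma p.2 : restrC (tens2 G));
  sigma_braid : forall t, homog 3 t ->
    leg2 sigma 0 (leg2 sigma 1 (leg2 sigma 0 t)) = leg2 sigma 1 (leg2 sigma 0 (leg2 sigma 1 t));
  sigma_ideal : forall a, calc_ideal a ->
    let t := \sum_(p <- sw H a) omega p.1 ⊗A omega p.2 in sigma t = t;
  sigma_S2 : forall t, sigma (S2_2 t) = S2_2 (sigma t);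
  sigma_star : (forall t, fstar2 (sigma t) = sigma (fstar2 t)) \/
             (forall t, fstar2 (sigma t) = sigmaV (fstar2 t))
}.

Section SigmaMetric.
Variable br : braiding.

Record sigma_metric := SigmaMetric {
  met : tens2 G -> A;
  metD : {morph met : t u / t + u};
  metZ : forall a (t : tens2 G), met (a *: t) = a * met t;
  metR : forall (t : tens2 G) a, met (ract2 t a) = met t * a;
  met_coact : forall t, cop H (met t) =
    \sum_(p <- repC (coact2 t)) p.1 ⊗ met (p.2 : tens2 G);
  met_ndegl : forall x, (forall y, met (x ⊗A y) = 0) -> x = 0;
  met_ndegr : forall y, (forall x, met (x ⊗A y) = 0) -> y = 0;
  met_sigma : forall t, met (sigma br t) = met t;
  met_leg : forall t, homog 3 t ->
    leg0 met 0 (leg2 (sigma br) 1 (leg2 (sigma br) 0 t)) = leg0 met 1 t;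
  met_leg' : forall t, homog 3 t ->
    leg0 met 0 (leg2 (sigmaV br) 1 (leg2 (sigmaV br) 0 t)) = leg0 met 1 t;
  met_star : forall x y, star H (met (x ⊗A y)) = met (fstar y ⊗A fstar x);
  met_S2 : forall x y, left_inv x -> left_inv y -> met (S2 y ⊗A x) = met (x ⊗A y)
}.

End SigmaMetric.
End CalculusDefs.

(* A reduced expression of a permutation as a product of the transpositions
   [(i i+1)], read off from its Lehmer code. *)
Section ReducedWord.
Import fingroup.fingroup.

Definition adj_tperm (k i : nat) : 'S_k :=
  if k is k'.+1 return 'S_k then tperm (inord i) (inord i.+1) else 1%g.

Definition lehmer (k : nat) (w : 'S_k) (i : 'I_k) : nat :=
  #|[set j : 'I_k | (i < j)%N && (w j < w i)%N]|.

Definition redword (k : nat) (w : 'S_k) : seq nat :=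
  flatten [seq iota i (lehmer w i) | i : 'I_k <- rev (enum 'I_k)].

(* The number of inversions. *)
Lemma size_redword k (w : 'S_k) :
  size (redword w) = #|[set p : 'I_k * 'I_k | (p.1 < p.2)%N && (w p.2 < w p.1)%N]|.
Proof.
rewrite size_flatten /shape -map_comp sumnE big_map.
rewrite (perm_big (enum 'I_k)) /=; last by rewrite perm_rev.
rewrite big_enum /= -sum1_card (eq_bigr (fun i : 'I_k => \sum_(j : 'I_k | (i < j)%N && (w j < w i)%N) 1)%N).
  by rewrite pair_big_dep /=; apply: eq_bigl => p; rewrite inE.
by move=> i _; rewrite size_iota /lehmer -sum1_card; apply: eq_bigl => j; rewrite inE.
Qed.

Lemma lehmer_lift k (w : 'S_k) (j : 'I_k.+1) i :
  lehmer (lift_perm ord0 j w) (lift ord0 i) = lehmer w i.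
Proof.
rewrite /lehmer -[RHS](card_imset _ (@lift_inj _ ord0)); apply: eq_card => l.
apply/idP/imsetP => [|[m + ->]]; rewrite !inE.
  case: (unliftP ord0 l) => [m ->|-> //]; rewrite !lift_perm_lift => /andP[h1 h2].
  exists m => //; rewrite inE; move: h1 h2; rewrite !lift0 ltnS => ->.
  by rewrite /= /bump; case: (leqP j (w m)); case: (leqP j (w i)) => /=; lia.
rewrite !lift_perm_lift !lift0 ltnS => /andP[-> h2].
by rewrite /= /bump; case: (leqP j (w m)); case: (leqP j (w i)) => /=; lia.
Qed.

Lemma lehmer0 k (w : 'S_k) (j : 'I_k.+1) : lehmer (lift_perm ord0 j w) ord0 = j.
Proof.
rewrite /lehmer lift_perm_id.
have -> : [set l : 'I_k.+1 | (0 < l)%N && (lift_perm ord0 j w l < j)%N]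
   = lift_perm ord0 j w @^-1: [set l : 'I_k.+1 | (l < j)%N].
  apply/setP => l; rewrite !inE; case: (unliftP ord0 l) => [m ->|->].
    by rewrite lift0.
  by rewrite lift_perm_id ltnn andbF.
rewrite card_preimset; last exact: perm_inj.
have -> : [set l : 'I_k.+1 | (l < j)%N] = widen_ord (ltnW (ltn_ord j)) @: [set: 'I_j].
  apply/setP => l; rewrite inE; apply/idP/imsetP => [lt|[m _ ->]]; last exact: (ltn_ord m).
  by exists (Ordinal lt) => //; apply: val_inj.
rewrite card_imset ?cardsT ?card_ord // => x y [] /val_inj //.
Qed.

Lemma redword_lift k (w : 'S_k) (j : 'I_k.+1) :
  redword (lift_perm ord0 j w) = map succn (redword w) ++ iota 0 j.
Proof.
rewrite /redword enum_ordSl rev_cons map_rcons flatten_rcons lehmer0; congr (_ ++ _).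
rewrite -map_rev -map_comp map_flatten -map_comp; congr flatten.
by apply: eq_map => i; rewrite [LHS]/comp lehmer_lift lift0 -add1n iotaDl.
Qed.

Lemma perm_liftE k (w : 'S_k.+1) :
  exists w' : 'S_k, w = lift_perm ord0 (w ord0) w'.
Proof.
pose f (i : 'I_k) := odflt i (unlift (w ord0) (w (lift ord0 i))).
have fE i : lift (w ord0) (f i) = w (lift ord0 i).
  rewrite /f; case: unliftP => [m -> //|e].
  by have := neq_lift ord0 i; rewrite -(inj_eq (@perm_inj _ w)) e eqxx.
have finj : injective f.
  by move=> x y e; apply: (@lift_inj _ ord0); apply: (@perm_inj _ w); rewrite -!fE e.
exists (perm finj); apply/permP => i; case: (unliftP ord0 i) => [m ->|->].
  by rewrite lift_perm_lift permE fE.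
by rewrite lift_perm_id.
Qed.

Lemma adj_tperm_succ k i : (i.+1 < k)%N ->
  adj_tperm k.+1 i.+1 = lift_perm ord0 ord0 (adj_tperm k i).
Proof.
case: k => // k lt; apply/permP => x /=.
have e j : (j <= k)%N -> inord j.+1 = lift ord0 (inord j : 'I_k.+1) :> 'I_k.+2.
  by move=> le; apply: val_inj; rewrite /= /bump leq0n add1n !inordK.
have lt' : (i < k)%N by rewrite -ltnS.
rewrite (e i (ltnW lt')) (e i.+1 lt').
case: (unliftP ord0 x) => [y ->|->].
  by rewrite lift_perm_lift; case: (tpermP (inord i) (inord i.+1) y) => [->|->|/eqP n1 /eqP n2];
    rewrite ?tpermL ?tpermR // tpermD // (inj_eq (@lift_inj _ _)) eq_sym.
by rewrite lift_perm_id tpermD // eq_sym neq_lift.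
Qed.

Lemma prod_iota k (j : 'I_k.+1) :
  (\prod_(i <- iota 0 j) adj_tperm k.+1 i)%g = lift_perm ord0 j 1%g.
Proof.
case: j => j; elim: j => [|j IH] lt.
  by rewrite big_nil (_ : Ordinal lt = ord0) ?lift_perm1 //; apply: val_inj.
have := iotaD 0 j 1; rewrite addn1 => e; rewrite [nat_of_ord _]/= e.
rewrite big_cat big_seq1 /= (IH (ltnW lt)); apply/permP => x.
rewrite permM /=.
have e1 : inord j = Ordinal (ltnW lt) :> 'I_k.+1 by apply: val_inj; rewrite /= inordK // ltnW.
have e2 : inord j.+1 = Ordinal lt :> 'I_k.+1 by apply: val_inj; rewrite /= inordK.
rewrite e1 e2; case: (unliftP ord0 x) => [y ->|->]; last by rewrite !lift_perm_id tpermL.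
rewrite !lift_perm_lift !perm1.
case: (tpermP (Ordinal (ltnW lt)) (Ordinal lt)) => [/(congr1 val)|/(congr1 val)|] /=.
- by rewrite /bump; case: leqP => /=; lia.
- by rewrite /bump => h; apply: val_inj; rewrite /= /bump; move: h; case: (leqP j y); case: (leqP j.+1 y) => /=; lia.
- move=> /eqP + /eqP; rewrite -!val_eqE /= /bump => n1 n2; apply: val_inj => /=.
  by rewrite /bump; move: n1 n2; case: (leqP j y); case: (leqP j.+1 y) => /=; lia.
Qed.

Lemma redword_bound k (w : 'S_k) : all (fun i => i.+1 < k)%N (redword w).
Proof.
elim: k w => [|k IH] w; first by rewrite /redword enum_ord0.
have [w' ->] := perm_liftE w; rewrite redword_lift all_cat all_map; apply/andP; split.
  exact: IH.
by apply/allP => i; rewrite mem_iota add0n ltnS => /leq_trans; apply; rewrite -ltnS.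
Qed.

Lemma redwordP k (w : 'S_k) : (\prod_(i <- redword w) adj_tperm k i)%g = w.
Proof.
elim: k w => [|k IH] w; first by apply/permP => -[].
have [w' ->] := perm_liftE w; rewrite redword_lift big_cat /= prod_iota big_map.
set j := w ord0.
have -> : (\prod_(i <- redword w') adj_tperm k.+1 i.+1)%g = lift_perm ord0 ord0 w'.
  rewrite -{2}[w']IH; move: (redword_bound w').
  elim: (redword w') => [|i s IHs]; first by rewrite !big_nil lift_perm1.
  by case/andP=> lt bs; rewrite !big_cons IHs // adj_tperm_succ // lift_permM.
by rewrite lift_permM mulg1.
Qed.

End ReducedWord.

Section ExteriorAlgebra.
Variables (C : numClosedFieldType) (A : algType C) (H : hopf_star A) (n : nat).
Variables (Gam : calculus H n) (br : braiding Gam).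
Local Notation G := (Gamma Gam).
Local Notation T := (talg G).

(* [sigma_(i1+1,i1+2) o ... o sigma_(ir+1,ir+2)] for the word [:: i1; ...; ir]. *)
Definition sigma_word (s : seq nat) (u : T) : T :=
  foldr (fun i v => leg2 (sigma br) i v) u s.

(* Woronowicz' antisymmetrizer [A_k], on [homog k]. *)
Definition antisym (k : nat) (u : T) : T :=
  \sum_(w : 'S_k) (-1) ^+ size (redword w) * sigma_word (redword w) u.

(* [B_(1,l-1)], on [homog l]. *)
Definition partial_antisym (l : nat) (u : T) : T :=
  \sum_(j < l) (-1) ^+ j * sigma_word (iota 0 j) u.

Lemma tmul2_sigmaD : {morph (fun t : tens2 G => tmul2 (sigma br t)) : t u / t + u}.
Proof. by move=> t u /=; rewrite sigmaD tmul2D. Qed.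

Lemma tmul2Z a (t : tens2 G) : tmul2 (a *: t) = temb G a * tmul2 t.
Proof.
elim/tens2_ind: t => [|x y|t u IHt IHu].
- have z : tmul2 (0 : tens2 G) = 0.
    by apply: (@addrI _ (tmul2 0)); rewrite -tmul2D !addr0.
  by rewrite scaler0 z mulr0.
- by rewrite tens2_scale !tmul2_tA tinjZ mulrA.
- by rewrite scalerDr !tmul2D IHt IHu mulrDr.
Qed.

Lemma tmul2R (t : tens2 G) a : tmul2 (ract2 t a) = tmul2 t * temb G a.
Proof.
elim/tens2_ind: t => [|x y|t u IHt IHu].
- have z : tmul2 (0 : tens2 G) = 0.
    by apply: (@addrI _ (tmul2 0)); rewrite -tmul2D !addr0.
  have -> : ract2 (0 : tens2 G) a = 0.
    by apply: (@addrI _ (ract2 (0 : tens2 G) a)); rewrite -ract2D !addr0.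
  by rewrite z mul0r.
- by rewrite ract2_tA !tmul2_tA tinjR mulrA.
- by rewrite ract2D !tmul2D IHt IHu mulrDl.
Qed.

Lemma tmul2_sigmaZ a (t : tens2 G) :
  tmul2 (sigma br (a *: t)) = temb G a * tmul2 (sigma br t).
Proof. by rewrite sigmaZ tmul2Z. Qed.

Lemma tmul2_sigmaR (t : tens2 G) a :
  tmul2 (sigma br (ract2 t a)) = tmul2 (sigma br t) * temb G a.
Proof. by rewrite sigmaR tmul2R. Qed.

Lemma sigma_word_cons i s u :
  sigma_word (i :: s) u = leg2 (sigma br) i (sigma_word s u).
Proof. by []. Qed.

Lemma sigma_wordD s : {morph sigma_word s : u v / u + v}.
Proof.
elim: s => [//|i s IH] u v; rewrite !sigma_word_cons IH.
exact: (placeD tmul2_sigmaD tmul2_sigmaZ tmul2_sigmaR).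
Qed.

Lemma sigma_wordZ s a u : sigma_word s (a *: u) = a *: sigma_word s u.
Proof.
elim: s => [//|i s IH]; rewrite !sigma_word_cons IH.
exact: (placeZ tmul2_sigmaD tmul2_sigmaZ tmul2_sigmaR).
Qed.

Lemma antisymD k : {morph antisym k : u v / u + v}.
Proof.
move=> u v; rewrite -big_split /=; apply: eq_bigr => w _.
by rewrite sigma_wordD mulrDr.
Qed.

Lemma antisymZ k a u : antisym k (a *: u) = a *: antisym k u.
Proof.
rewrite scaler_sumr; apply: eq_bigr => w _; rewrite sigma_wordZ.
by rewrite -signr_odd !mulr_sign; case: odd; rewrite ?scalerN.
Qed.

Lemma antisym0 k : antisym k 0 = 0.
Proof. by apply: (@addrI _ (antisym k 0)); rewrite -antisymD !addr0. Qed.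

Lemma antisymB k u v : antisym k (u - v) = antisym k u - antisym k v.
Proof.
suff N : antisym k (- v) = - antisym k v by rewrite antisymD N.
by apply/eqP; rewrite -addr_eq0 -antisymD addNr antisym0.
Qed.

(* The direct sum of the kernels of the [A_k]. *)
Definition ker_antisym : {pred T} :=
  fun u => `[< forall k, antisym k (hproj k u) = 0 >].

Lemma ker_antisym_closed : zmod_closed ker_antisym.
Proof.
split=> [|u v /asboolP uK /asboolP vK]; apply/asboolP => k.
  by rewrite hproj0 antisym0.
by rewrite hprojD hprojN antisymB uK vK subrr.
Qed.

HB.instance Definition _ := GRing.isZmodClosed.Build T ker_antisym ker_antisym_closed.

Lemma ker_antisymZ a u : u \in ker_antisym -> a *: u \in ker_antisym.
Proof.
by move=> /asboolP uK; apply/asboolP => k; rewrite hprojZ antisymZ uK scaler0.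
Qed.

(* Woronowicz' external algebra, as a left A-module. *)
Definition ext : Type := Quotient.quot ker_antisym.
HB.instance Definition _ := GRing.Zmodule.on ext.

Definition ext_pi (u : T) : ext := \pi_(Quotient.quot ker_antisym) u.
Definition ext_repr (x : ext) : T := repr (x : Quotient.quot ker_antisym).

Lemma ext_reprK : cancel ext_repr ext_pi.
Proof. by move=> x; apply: reprK. Qed.

Lemma ext_eqP u v : reflect (ext_pi u = ext_pi v) (u - v \in ker_antisym).
Proof. by rewrite Quotient.idealrBE; apply: eqP. Qed.

Lemma ext_piD : {morph ext_pi : u v / u + v}.
Proof. exact: Quotient.pi_add. Qed.

Definition ext_scale (a : A) (x : ext) : ext := ext_pi (a *: ext_repr x).

Lemma ext_scaleE a u : ext_scale a (ext_pi u) = ext_pi (a *: u).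
Proof.
apply/ext_eqP; rewrite -scalerBr; apply: ker_antisymZ.
by apply/ext_eqP; rewrite ext_reprK.
Qed.

Lemma ext_scaleA a b x : ext_scale a (ext_scale b x) = ext_scale (a * b) x.
Proof. by rewrite -[x]ext_reprK !ext_scaleE scalerA. Qed.
Lemma ext_scale1 : left_id 1 ext_scale.
Proof. by move=> x; rewrite -[x]ext_reprK ext_scaleE scale1r. Qed.
Lemma ext_scaleDr : right_distributive ext_scale +%R.
Proof.
move=> a x y; rewrite -[x]ext_reprK -[y]ext_reprK -ext_piD !ext_scaleE.
by rewrite scalerDr ext_piD.
Qed.
Lemma ext_scaleDl x : {morph ext_scale^~ x : a b / a + b}.
Proof. by move=> a b; rewrite -[x]ext_reprK !ext_scaleE scalerDl ext_piD. Qed.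

HB.instance Definition _ := GRing.Zmodule_isLmodule.Build A ext
  ext_scaleA ext_scale1 ext_scaleDr ext_scaleDl.

(* The product of the external algebra, computed on representatives. *)
Definition wedge (x y : ext) : ext := ext_pi (ext_repr x * ext_repr y).

Section Contraction.
Variable g : sigma_metric br.

(* [<<w, u>>] on the tensor algebra, and on representatives in [ext]. *)
Definition contr (w : G) (u : T) : T :=
  \sum_(l < (tdeg u).+1)
    leg0 (met g) 0 (tinj w * partial_antisym l (hproj l u)).

Definition ext_contr (w : G) (x : ext) : ext := ext_pi (contr w (ext_repr x)).

(* The ideal defining the Clifford algebra, and the Clifford algebra. *)
Definition cl_ideal : {pred T} := fun u =>
  `[< exists2 s : seq (T * tens2 G * T),
        (forall p, p \in s -> sigma br p.1.2 = p.1.2) &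
        u = \sum_(p <- s) p.1.1 * (tmul2 p.1.2 - temb G (met g p.1.2)) * p.2 >].

Lemma cl_ideal_closed : zmod_closed cl_ideal.
Proof.
split=> [|u v /asboolP[s sS ->] /asboolP[r rS ->]]; apply/asboolP.
  by exists [::]; rewrite ?big_nil.
exists (s ++ [seq (- p.1.1, p.1.2, p.2) | p <- r]).
  by move=> p; rewrite mem_cat => /orP[/sS //|/mapP[q /rS ? ->]].
rewrite big_cat big_map /= -sumrN; congr (_ + _).
by apply: eq_bigr => p _; rewrite !mulNr.
Qed.

HB.instance Definition _ := GRing.isZmodClosed.Build T cl_ideal cl_ideal_closed.

Lemma cl_idealMl a u : u \in cl_ideal -> a * u \in cl_ideal.
Proof.
move=> /asboolP[s sS ->]; apply/asboolP.
exists [seq (a * p.1.1, p.1.2, p.2) | p <- s].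
  by move=> _ /mapP[q /sS ? ->].
by rewrite big_map mulr_sumr; apply: eq_bigr => p _; rewrite !mulrA.
Qed.

Lemma cl_idealMr a u : u \in cl_ideal -> u * a \in cl_ideal.
Proof.
move=> /asboolP[s sS ->]; apply/asboolP.
exists [seq (p.1.1, p.1.2, p.2 * a) | p <- s].
  by move=> _ /mapP[q /sS ? ->].
by rewrite big_map mulr_suml; apply: eq_bigr => p _; rewrite !mulrA.
Qed.

Definition clifford : Type := Quotient.quot cl_ideal.
HB.instance Definition _ := GRing.Zmodule.on clifford.

Definition cl_pi (u : T) : clifford := \pi_(Quotient.quot cl_ideal) u.
Definition cl_repr (x : clifford) : T := repr (x : Quotient.quot cl_ideal).

Lemma cl_reprK : cancel cl_repr cl_pi.
Proof. by move=> x; apply: reprK. Qed.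

Lemma cl_eqP u v : reflect (cl_pi u = cl_pi v) (u - v \in cl_ideal).
Proof. by rewrite Quotient.idealrBE; apply: eqP. Qed.

Lemma cl_piD : {morph cl_pi : u v / u + v}.
Proof. exact: Quotient.pi_add. Qed.

Definition cl_mul (x y : clifford) : clifford := cl_pi (cl_repr x * cl_repr y).
Definition cl_one : clifford := cl_pi 1.

Lemma cl_mulE u v : cl_mul (cl_pi u) (cl_pi v) = cl_pi (u * v).
Proof.
apply/cl_eqP; set u' := cl_repr _; set v' := cl_repr _.
have -> : u' * v' - u * v = (u' - u) * v' + u * (v' - v).
  by rewrite mulrBl mulrBr addrA subrK.
by apply: rpredD; [apply: cl_idealMr|apply: cl_idealMl]; apply/cl_eqP; rewrite cl_reprK.
Qed.

Lemma cl_mulA : associative cl_mul.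
Proof.
move=> x y z; rewrite -[x]cl_reprK -[y]cl_reprK -[z]cl_reprK.
by rewrite !cl_mulE mulrA.
Qed.
Lemma cl_mul1 : left_id cl_one cl_mul.
Proof. by move=> x; rewrite -[x]cl_reprK cl_mulE mul1r. Qed.
Lemma cl_mulr1 : right_id cl_one cl_mul.
Proof. by move=> x; rewrite -[x]cl_reprK cl_mulE mulr1. Qed.
Lemma cl_mulDl : left_distributive cl_mul +%R.
Proof.
move=> x y z; rewrite -[x]cl_reprK -[y]cl_reprK -[z]cl_reprK.
by rewrite -cl_piD !cl_mulE mulrDl cl_piD.
Qed.
Lemma cl_mulDr : right_distributive cl_mul +%R.
Proof.
move=> x y z; rewrite -[x]cl_reprK -[y]cl_reprK -[z]cl_reprK.
by rewrite -cl_piD !cl_mulE mulrDr cl_piD.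
Qed.

HB.instance Definition _ := GRing.Zmodule_isPzRing.Build clifford
  cl_mulA cl_mul1 cl_mulr1 cl_mulDl cl_mulDr.

Definition cl_emb (a : A) : clifford := cl_pi (temb G a).
Definition cl_inj (w : G) : clifford := cl_pi (tinj w).

(* Representations of the complex algebra [clifford] on the vector space [ext];
   scalars c act as [c%:A]. *)
Definition cl_representation (r : clifford -> ext -> ext) : Prop :=
  [/\ forall c u v x,
        r (cl_emb c%:A * u + v) x = (c%:A : A) *: r u x + r v x,
      forall u c x y, r u ((c%:A : A) *: x + y) = (c%:A : A) *: r u x + r u y,
      forall x, r 1 x = x &
      forall u v x, r (u * v) x = r u (r v x)].

Definition cl_action_formulas (r : clifford -> ext -> ext) : Prop :=
  (forall a x, r (cl_emb a) x = a *: x) /\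
  (forall w x, r (cl_inj w) x = wedge (ext_pi (tinj w)) x + ext_contr w x).

End Contraction.
End ExteriorAlgebra.

(* Main.v *)
Require Import Defs.
From mathcomp Require Import all_boot all_order all_algebra complex.
From mathcomp Require Import reals.
From HB Require Import structures.
From mathcomp Require Import fingroup perm zify boolp.

(** The representation exists because product, braiding and metric are already
    compatible on the tensor algebra, where everything reduces to identities
    between the operators [sigma_i] and [g_i] that apply the braiding
    and the metric to the factors i+1 and i+2. These operators live in the ring
    of additive endomorphisms of the tensor algebra, where the [sigma_i] satisfy
    the braid relations in every degree (they vanish in low degrees), so the
    combinatorics of antisymmetrizers can be done in an abstract ring with braid
    generators.

    The exterior algebra. The antisymmetrizer A_(k+1) has three factorizations:
    A' B by definition of reduced words, with A' the antisymmetrizer of the last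
    k factors; R A', because A is invariant under reversal of words
    ([antisymmetrizerS_rev]); and X A, with A that of the first k factors
    ([antisymmetrizerS_back]). The last two show that the kernels form a
    two-sided ideal. The first one shows that contractions preserve these
    kernels: A_k passes through g_12 (w ⊗ -) and meets B ([ker_antisym_contr]).

    The Clifford relations. Let t = sum x ⊗ y be invariant under sigma. Acting
    twice on a representative u of degree l gives five terms. The exterior
    product t u lies in the kernel of the antisymmetrizer, because A_2 t = 0. Of
    the terms of degree l, one is g(t) u, and the other two are g_23 (t ⊗ B u)
    and - g_12 sigma_23 (t ⊗ B u), which cancel since the compatibility of g and
    sigma turns the second into the first on invariant t. The term of degree
    l - 2 is g_12 g_23 (t ⊗ B' B u). Here B' B = (1 - sigma_12) Y ([front_sum2]),
    and under the nested contraction g_12 g_23 a braiding of the last two of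
    four factors acts as one of the first two ([met_met_sigma]), so this term
    vanishes because sigma t = t.

    By the universal property of the tensor algebra the operators of A and G
    therefore define a representation of the Clifford algebra, and it is unique
    because A and G generate. *)

Set Implicit Arguments.
Unset Strict Implicit.
Unset Printing Implicit Defensive.

Import GRing.Theory.
Local Open Scope ring_scope.

(** * Antisymmetrizers in a ring with braid generators *)

Section BraidedRing.
Variables (E : pzRingType) (s : nat -> E).

(** The alternating sum [1 - s_o + s_o s_(o+1) - ...] with [l] terms, over the
    permutations that bring one of [l] letters to the front: this is B_(1,l-1)
    on the letters from [o] on, written by Horner's rule so that every identity
    below becomes an induction instead of a manipulation of double sums. *)
Fixpoint front_sum (o l : nat) : E :=
  if l is l'.+1 then 1 - s o * front_sum o.+1 l' else 0.

(** The words of [front_sum] read backwards. *)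
Fixpoint front_sum_rev (o l : nat) : E :=
  if l is l'.+1 then 1 - front_sum_rev o.+1 l' * s o else 0.

(** The alternating sum over the permutations that bring the last of [k]
    letters to an arbitrary place: it splits the antisymmetrizer on the right
    as [front_sum_rev] splits it on the left. *)
Fixpoint back_sum (o k : nat) : E :=
  if k is k'.+1 then 1 - back_sum o k' * s (o + k'.-1) else 0.

(** Each permutation is the one that brings a letter to the front followed by
    one of the remaining letters. *)
Fixpoint antisymmetrizer (o k : nat) : E :=
  if k is k'.+1 then antisymmetrizer o.+1 k' * front_sum o k else 1.

Lemma antisymmetrizerS o k :
  antisymmetrizer o k.+1 = antisymmetrizer o.+1 k * front_sum o k.+1.
Proof. by []. Qed.

Lemma front_sumS o l : front_sum o l.+1 = 1 - s o * front_sum o.+1 l.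
Proof. by []. Qed.

(** An element that conjugates the generators into shifted ones conjugates
    every expression in them. The bound [N] is there for multiplications from
    the right in the tensor algebra, which pass only through the generators
    that do not reach beyond the factors of the left-hand element. *)
Lemma front_sum_intertwine (h : E) p q N :
  (forall i, (i < N)%N -> h * s (i + p) = s (i + q) * h) ->
  forall l o, (o + l <= N.+1)%N -> h * front_sum (o + p) l = front_sum (o + q) l * h.
Proof.
move=> hs; elim=> [|l IH] o le /=; first by rewrite mulr0 mul0r.
rewrite mulrBr mulrBl mulr1 mul1r; congr (_ - _).
case: l IH le => [|l] IH le; first by rewrite /= !mulr0 mul0r.
by rewrite mulrA hs ?mulrA -?mulrA ?(IH o.+1); [|lia..].
Qed.

Lemma antisymmetrizer_intertwine (h : E) p q N :
  (forall i, (i < N)%N -> h * s (i + p) = s (i + q) * h) ->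
  forall k o, (o + k <= N.+1)%N ->
  h * antisymmetrizer (o + p) k = antisymmetrizer (o + q) k * h.
Proof.
move=> hs; elim=> [|k IH] o le; first by rewrite mulr1 mul1r.
rewrite !antisymmetrizerS mulrA (IH o.+1); last by lia.
by rewrite -!mulrA (front_sum_intertwine hs).
Qed.

Hypothesis far : forall i j, (i.+1 < j)%N -> s i * s j = s j * s i.

(** The antisymmetrizer is invariant under reversal of words. Both sides equal
    [(1 - R s_o) A] with [A], [R] taken on the letters after [o]: expand
    [front_sum] on the left, use the induction hypothesis, and move [s_o]
    through the antisymmetrizer of the letters after [o + 1]. *)
Lemma antisymmetrizerS_rev o k :
  antisymmetrizer o k.+1 = front_sum_rev o k.+1 * antisymmetrizer o.+1 k.
Proof.
elim: k o => [|k IH] o; first by rewrite /= mulr0 mul0r mulr1 mul1r.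
have comm : s o * antisymmetrizer o.+2 k = antisymmetrizer o.+2 k * s o.
  apply: (@antisymmetrizer_intertwine (s o) o.+2 o.+2 k _ k 0) => // i _.
  by rewrite far //; lia.
transitivity (antisymmetrizer o.+1 k.+1 * (1 - s o * front_sum o.+1 k.+1)).
  by [].
rewrite mulrBr mulr1 {2}IH.
transitivity ((1 - front_sum_rev o.+1 k.+1 * s o) * antisymmetrizer o.+1 k.+1);
  last by [].
rewrite [RHS]mulrBl mul1r; congr (_ - _).
rewrite -!mulrA; congr (_ * _).
by rewrite mulrA -comm -mulrA.
Qed.

Hypothesis braid : forall i, s i * s i.+1 * s i = s i.+1 * s i * s i.+1.

(** The induction step of [front_sum2]. *)
Lemma factor_out_braid (a b c u y : E) : a * b * a = b * a * b ->
  a * c = c * a -> u = 1 - b * c -> c * u = (1 - b) * y ->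
  u * (1 - a * u) = (1 - a) * (u + b * a * y).
Proof.
move=> ab ac uE cu.
have -> : u * (1 - a * u) = u - a * u + b * a * (c * u).
  rewrite mulrBr mulr1 mulrA {2}uE [(1 - _) * a]mulrBl mul1r mulrBl opprB.
  by rewrite addrA addrAC -!mulrA [a * (c * u)]mulrA ac -!mulrA.
rewrite cu mulrDr [(1 - a) * u]mulrBl mul1r; congr (_ + _).
by rewrite !(mulrBl _ 1) !mul1r mulrBr !mulrA ab.
Qed.

(** Bringing two letters to the front one after the other gives both orders of
    the two letters with opposite signs, hence a left factor [1 - s_o]. *)
Lemma front_sum2 o l : exists y,
  front_sum o.+1 l * front_sum o l.+1 = (1 - s o) * y.
Proof.
elim: l o => [|l IH] o; first by exists 0; rewrite mul0r mulr0.
have [y yE] := IH o.+1; exists (front_sum o.+1 l.+1 + s o.+1 * s o * y).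
apply: factor_out_braid yE => //.
apply: (@front_sum_intertwine (s o) o.+2 o.+2 l _ l 0) => // i _.
by rewrite far //; lia.
Qed.

(** The word [s_(o+k-1) ... s_o] that carries one letter past [k] others, so
    that it conjugates each inner generator into its neighbour. *)
Fixpoint descent (o k : nat) : E :=
  if k is k'.+1 then s (o + k') * descent o k' else 1.

Lemma descent_far o k j : (o + k < j)%N -> descent o k * s j = s j * descent o k.
Proof.
elim: k => [|k IH] lt /=; first by rewrite mul1r mulr1.
rewrite -mulrA IH; last by lia.
by rewrite !mulrA far //; lia.
Qed.

Lemma descent_shift o k j : (j.+1 < k)%N ->
  descent o k * s (o + j).+1 = s (o + j) * descent o k.
Proof.
elim: k => [//|k IH] lt /=.
have [lt'|le] := ltnP j.+1 k.
  by rewrite -mulrA IH // !mulrA (@far (o + j)) //; lia.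
have -> : k = j.+1 by lia.
rewrite /= addnS -!mulrA descent_far; last by lia.
by rewrite !mulrA -braid.
Qed.

Lemma descentSr o k : descent o k.+1 = descent o.+1 k * s o.
Proof.
elim: k => [|k IH]; first by rewrite /= addn0 mulr1 mul1r.
by rewrite -[LHS]/(s (o + k.+1) * descent o k.+1) IH mulrA addnS -addSn.
Qed.

Lemma back_sum_descent o m k : (m <= k)%N ->
  descent o k * back_sum o.+1 m = back_sum o m * descent o k.
Proof.
elim: m => [|m IH] le /=; first by rewrite mulr0 mul0r.
rewrite mulrBr mulrBl mulr1 mul1r mulrA IH; last by lia.
case: m IH le => [|m] IH le; first by rewrite /= !mul0r.
by rewrite -mulrA addSn descent_shift // !mulrA.
Qed.

Lemma front_sum_revSr o k :
  front_sum_rev o k.+1 = front_sum_rev o k + (-1) ^+ k * descent o k.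
Proof.
elim: k o => [|k IH] o; first by rewrite /= mul0r subr0 add0r mulr1.
rewrite -[LHS]/(1 - front_sum_rev o.+1 k.+1 * s o) IH /= mulrDl opprD addrA.
by congr (_ + _); rewrite exprS mulN1r mulNr -mulrA -descentSr.
Qed.

Lemma front_sum_rev_far o k j :
  (o + k <= j)%N -> front_sum_rev o k * s j = s j * front_sum_rev o k.
Proof.
elim: k o => [|k IH] o le /=; first by rewrite mulr0 mul0r.
rewrite mulrBl mulrBr mulr1 mul1r; congr (_ - _).
case: k IH le => [|k] IH le; first by rewrite !mul0r mulr0.
rewrite -[LHS]mulrA far; last by lia.
by rewrite [RHS]mulrA -IH ?mulrA //; lia.
Qed.

(** The induction step of [front_sum_rev_back_sum], where [d] and [d'] stand for
    the signed longest words of two consecutive front sums. *)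
Lemma back_sum_step (b b' d d' x1 x1' x t : E) :
  x1 = 1 - x1' * t -> b = b' + d' -> t * d' = - d -> b' * t = t * b' ->
  d * x1 = x * d -> b * x1' = x * b' -> (b + d) * x1 = (1 - x * t) * b.
Proof.
move=> x1E bE td bt dx bx.
rewrite mulrDl dx x1E mulrBr mulr1 mulrA bx mulrBl mul1r -[x * t * b]mulrA.
by rewrite {3}bE [t * _]mulrDr td mulrBr -bt opprB addrA addrAC -mulrA.
Qed.

(** Lengthening [front_sum_rev] by one letter adds a signed [descent], which
    conjugates [back_sum o.+1] into [back_sum o]. *)
Lemma front_sum_rev_back_sum o k :
  front_sum_rev o k.+1 * back_sum o.+1 k = back_sum o k.+1 * front_sum_rev o k.
Proof.
elim: k => [|k IH]; first by rewrite /= !mulr0.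
rewrite (front_sum_revSr o k.+1).
apply: back_sum_step (front_sum_revSr o k) _ _ _ IH; last 1 first.
- by rewrite -mulrA back_sum_descent // !mulrA commr_sign.
- by rewrite /= addSn; case: k => [|k] //=; rewrite ?mul0r // addnS.
- by rewrite mulrA commr_sign exprS mulN1r mulNr opprK -mulrA.
- by rewrite front_sum_rev_far.
Qed.

(** With [antisymmetrizerS_rev] this makes the kernels of the antisymmetrizers a
    two-sided ideal: the right factor involves only the last, respectively
    only the first, [k] of the [k + 1] letters. *)
Lemma antisymmetrizerS_back o k :
  antisymmetrizer o k.+1 = back_sum o k.+1 * antisymmetrizer o k.
Proof.
elim: k o => [|k IH] o; first by rewrite /= mulr0 mul0r mul1r mulr1.
by rewrite antisymmetrizerS_rev IH mulrA front_sum_rev_back_sum -mulrA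
   -antisymmetrizerS_rev.
Qed.

End BraidedRing.

(** * The ring of additive endomorphisms *)

Section AdditiveEndomorphisms.
Variable V : zmodType.

Record add_endo := AddEndo {
  endo_fun :> V -> V;
  endoD : {morph endo_fun : u v / u + v}
}.

Lemma add_endoP (f g : add_endo) : f =1 g -> f = g.
Proof.
case: f g => f fD [g gD] /= /funext fg; case: _ / fg in gD *.
by rewrite (Prop_irrelevance fD gD).
Qed.

HB.instance Definition _ := gen_eqMixin add_endo.
HB.instance Definition _ := gen_choiceMixin add_endo.

Definition endo_zero := @AddEndo (fun=> 0) (fun u v => esym (addr0 0)).
Definition endo_one := @AddEndo id (fun u v => erefl).
Definition endo_opp (f : add_endo) :=
  @AddEndo (fun u => - f u) (fun u v => etrans (congr1 -%R (endoD f u v)) (opprD _ _)).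
Definition endo_add (f g : add_endo) := @AddEndo (fun u => f u + g u)
  (fun u v => etrans (congr2 +%R (endoD f u v) (endoD g u v)) (addrACA _ _ _ _)).
Definition endo_mul (f g : add_endo) := @AddEndo (fun u => f (g u))
  (fun u v => etrans (congr1 f (endoD g u v)) (endoD f _ _)).

Lemma endo_addA : associative endo_add.
Proof. by move=> f g h; apply: add_endoP => u /=; rewrite addrA. Qed.
Lemma endo_addC : commutative endo_add.
Proof. by move=> f g; apply: add_endoP => u /=; rewrite addrC. Qed.
Lemma endo_add0 : left_id endo_zero endo_add.
Proof. by move=> f; apply: add_endoP => u /=; rewrite add0r. Qed.
Lemma endo_addN : left_inverse endo_zero endo_opp endo_add.
Proof. by move=> f; apply: add_endoP => u /=; rewrite addNr. Qed.

HB.instance Definition _ :=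
  GRing.isZmodule.Build add_endo endo_addA endo_addC endo_add0 endo_addN.

Lemma endo_mulA : associative endo_mul.
Proof. by move=> f g h; apply: add_endoP. Qed.
Lemma endo_mul1 : left_id endo_one endo_mul.
Proof. by move=> f; apply: add_endoP. Qed.
Lemma endo_mulr1 : right_id endo_one endo_mul.
Proof. by move=> f; apply: add_endoP. Qed.
Lemma endo_mulDl : left_distributive endo_mul endo_add.
Proof. by move=> f g h; apply: add_endoP. Qed.
Lemma endo_mulDr : right_distributive endo_mul endo_add.
Proof. by move=> f g h; apply: add_endoP => u; apply: endoD. Qed.

HB.instance Definition _ := GRing.Zmodule_isPzRing.Build add_endo
  endo_mulA endo_mul1 endo_mulr1 endo_mulDl endo_mulDr.

Lemma endoME (f g : add_endo) u : (f * g) u = f (g u). Proof. by []. Qed.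
Lemma endoDE (f g : add_endo) u : (f + g) u = f u + g u. Proof. by []. Qed.
Lemma endoNE (f : add_endo) u : (- f) u = - f u. Proof. by []. Qed.
Lemma endo1E u : (1 : add_endo) u = u. Proof. by []. Qed.
Lemma endo0E u : (0 : add_endo) u = 0. Proof. by []. Qed.

Lemma endo0 (f : add_endo) : f 0 = 0.
Proof. by apply: (@addrI _ (f 0)); rewrite -endoD !addr0. Qed.

Lemma endoN (f : add_endo) u : f (- u) = - f u.
Proof. by apply/eqP; rewrite -addr_eq0 -endoD addNr endo0. Qed.

Lemma endo_sum (f : add_endo) I (r : seq I) (F : I -> V) :
  f (\sum_(i <- r) F i) = \sum_(i <- r) f (F i).
Proof. exact: (big_morph _ (endoD f) (endo0 f)). Qed.

Lemma endo_sumE I (r : seq I) (F : I -> add_endo) u :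
  (\sum_(i <- r) F i) u = \sum_(i <- r) F i u.
Proof. exact: (big_morph (fun f : add_endo => f u)). Qed.

End AdditiveEndomorphisms.

(** * Operators acting on neighbouring tensor factors *)

Section Placement.
Variables (C : fieldType) (A : algType C) (G : bimodule A).
Local Notation T := (talg G).
Implicit Types (a b : A) (x y z : G) (u v : T) (t : tens2 G) (s : seq G).

Lemma tgen_cons a x s : tgen a (x :: s) = tinj (a *: x) * tgen 1 s.
Proof. by rewrite tgenM /= ract1 -tgen_head mul1r. Qed.

(** Induction on the degree, along the splitting of the tensor algebra into [A]
    and the multiples of elements of [G]. *)
Lemma talg_cons_ind (P : T -> Prop) :
  (forall a, P (temb G a)) -> (forall x u, P u -> P (tinj x * u)) ->
  (forall u v, P u -> P v -> P (u + v)) -> forall u, P u.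
Proof.
move=> Pa Px PD; elim/talg_ind => [|a s|//].
  by have := Pa 0; rewrite /temb tgen0.
elim: s a => [|x s IH] a; first exact: Pa.
by rewrite tgen_cons; apply: Px.
Qed.

Lemma tmul20 : tmul2 (0 : tens2 G) = 0.
Proof. exact: (tlift0 (tmul2_balanced G)). Qed.

Lemma homog_hproj k u : homog k (hproj k u).
Proof.
apply: (talg_eqP (f := fun u : T => hproj k (hproj k u))) u; try exact: hprojD.
  by move=> u v; rewrite !hprojD.
by move=> a s; rewrite hproj_gen; case: ifP => // e; rewrite ?hproj_gen ?e ?hproj0.
Qed.

Lemma homogD k u v : homog k u -> homog k v -> homog k (u + v).
Proof. by rewrite /homog hprojD => -> ->. Qed.

Lemma homog0 k : homog k (0 : T).
Proof. exact: hproj0. Qed.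

Lemma homog_gen k a s : size s = k -> homog k (tgen a s).
Proof. by rewrite /homog hproj_gen => ->; rewrite eqxx. Qed.

Lemma homog_ind k (P : T -> Prop) :
  P 0 -> (forall a s, size s = k -> P (tgen a s)) ->
  (forall u v, P u -> P v -> P (u + v)) -> forall u, homog k u -> P u.
Proof.
move=> P0 Pg PD u <-; elim/talg_ind: u => [|a s|u v IHu IHv].
- by rewrite hproj0.
- by rewrite hproj_gen; case: eqP => // /Pg.
- by rewrite hprojD; apply: PD.
Qed.

Lemma size_wract s a : size (wract s a) = size s.
Proof. by case/lastP: s => // s x; rewrite wract_rcons !size_rcons. Qed.

Lemma homogM j k u v : homog j u -> homog k v -> homog (j + k) (u * v).
Proof.
move=> uj vk; elim/homog_ind: uj => {u} [|a s sj|u u' IHu IHu'].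
- by rewrite mul0r; apply: homog0.
- elim/homog_ind: vk => {v} [|b r rk|v v' IHv IHv'].
  + by rewrite mulr0; apply: homog0.
  + by rewrite tgenM; apply: homog_gen; rewrite size_cat size_wract sj rk.
  + by rewrite mulrDr; apply: homogD.
- by rewrite mulrDl; apply: homogD.
Qed.

Lemma homog_tinj x : homog 1 (tinj x).
Proof. exact: homog_gen. Qed.

Lemma homog_temb a : homog 0 (temb G a).
Proof. exact: homog_gen. Qed.

Lemma homog_tinjM k x u : homog k u -> homog k.+1 (tinj x * u).
Proof. exact: (@homogM 1 k _ _ (homog_tinj x)). Qed.

Lemma homogM_tinj k x u : homog k u -> homog k.+1 (u * tinj x).
Proof. by move=> uk; rewrite -addn1; apply: homogM uk (homog_tinj x). Qed.

Lemma homogM_temb k a u : homog k u -> homog k (u * temb G a).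
Proof. by move=> uk; rewrite -(addn0 k); apply: homogM uk (homog_temb a). Qed.

Lemma homog_tmul2 t : homog 2 (tmul2 t).
Proof.
elim/tens2_ind: t => [|x y|t t' IHt IHt'].
- by rewrite tmul20; apply: homog0.
- by rewrite tmul2_tA; apply: (@homogM 1 1); apply: homog_tinj.
- by rewrite tmul2D; apply: homogD.
Qed.

Lemma hproj_homog j k u : homog j u -> hproj k u = if k == j then u else 0.
Proof.
elim/homog_ind => {u} [|a s sj|u v IHu IHv].
- by rewrite hproj0 if_same.
- by rewrite hproj_gen sj eq_sym.
- by rewrite hprojD IHu IHv; case: ifP; rewrite ?addr0.
Qed.

(** An identity between operators on the first [k] factors need only be checked
    on k-fold tensors, up to a right factor, once the low degrees, where such
    operators usually vanish, are dealt with. *)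
Lemma talg_split_eq k (F F' : T -> T) :
  {morph F : u v / u + v} -> {morph F' : u v / u + v} ->
  (forall j u, (j < k)%N -> homog j u -> F u = F' u) ->
  (forall u v, homog k u -> F (u * v) = F' (u * v)) -> F =1 F'.
Proof.
move=> FD FD' lo hi; apply: talg_eqP => // a s.
have [lt|le] := ltnP (size s) k; first by apply: lo lt _; apply: homog_gen.
have -> : tgen a s = tgen a (take k s) * tgen 1 (drop k s).
  rewrite tgenM wract1 cat_take_drop; case: (take k s) => //=.
  by rewrite mulr1.
by apply: hi; apply: homog_gen; rewrite size_takel.
Qed.

(** The maps that can be placed on two neighbouring factors; their values have
    degree [m], which is 2 for a braiding and 0 for a metric. *)
Record bimodule_map (f : tens2 G -> T) (m : nat) : Prop := BimoduleMap {
  bmapD : {morph f : t u / t + u};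
  bmapZ : forall a t, f (a *: t) = temb G a * f t;
  bmapR : forall t a, f (ract2 t a) = f t * temb G a;
  bmap_homog : forall t, homog m (f t)
}.

Lemma tgen_cons2 a x y s : tgen a (x :: y :: s) = tmul2 ((a *: x) ⊗A y) * tgen 1 s.
Proof. by rewrite tmul2_tA -mulrA tgen_cons [tinj y * _]tgenM /= ract1. Qed.

Section OnePlace.
Variable f : tens2 G -> T.
Variable m : nat.
Hypothesis fB : bimodule_map f m.
Let fD := bmapD fB.
Let fZ := bmapZ fB.
Let fR := bmapR fB.

Definition place_at i : add_endo T := AddEndo (placeD fD fZ fR i).

Lemma place_at_gen i a s : place_at i (tgen a s) = temb G a * wplace f i s.
Proof. exact: place_gen. Qed.

Lemma place_atZ i a u : place_at i (temb G a * u) = temb G a * place_at i u.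
Proof. exact: (placeZ fD fZ fR i a u). Qed.

Lemma place_at_small i k u : (k <= i.+1)%N -> homog k u -> place_at i u = 0.
Proof.
move=> le; elim/homog_ind => {u} [|a s sk|u v IHu IHv]; first exact: endo0.
  rewrite place_at_gen; suff -> : wplace f i s = 0 by rewrite mulr0.
  rewrite -{}sk in le *; elim: i s le => [|i IH] [|x s] //= le.
    by case: s le.
  by rewrite IH ?mulr0.
by rewrite endoD IHu IHv addr0.
Qed.

Lemma place_atS i x u : place_at i.+1 (tinj x * u) = tinj x * place_at i u.
Proof.
elim/talg_ind: u => [|a s|u v IHu IHv]; first by rewrite mulr0 !endo0 mulr0.
  by rewrite tgenM !place_at_gen /= temb1 mul1r tinjR mulrA.
by rewrite mulrDr !endoD mulrDr IHu IHv.
Qed.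

Lemma place_at0 t u : place_at 0 (tmul2 t * u) = f t * u.
Proof.
elim/talg_ind: u => [|a s|u v IHu IHv]; first by rewrite !mulr0 endo0.
  elim/tens2_ind: t => [|x y|t t' IHt IHt'].
  - have -> : f 0 = 0 by apply: (@addrI _ (f 0)); rewrite -fD !addr0.
    by rewrite tmul20 !mul0r endo0.
  - rewrite tmul2_tA -mulrA !tgenM place_at_gen /= ract1 temb1 mul1r -ract2_tA fR.
    by rewrite -mulrA tembgen.
  - by rewrite tmul2D fD !mulrDl endoD IHt IHt'.
by rewrite !mulrDr endoD IHu IHv.
Qed.

(** Right multiplication commutes with an operator only when that operator fits
    inside the left factor: in lower degrees it vanishes there. *)
Lemma place_atMr k i u v : (i.+1 < k)%N -> homog k u ->
  place_at i (u * v) = place_at i u * v.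
Proof.
move=> lt; elim/homog_ind => {u} [|a s sk|u u' IHu IHu'].
- by rewrite mul0r endo0 mul0r.
- rewrite -{}sk in lt *; elim: i s a lt => [|i IH] [|x s] a lt //.
    case: s lt => // y s _.
    by rewrite tgen_cons2 -mulrA !place_at0 mulrA.
  by rewrite tgen_cons -mulrA !place_atS IH // mulrA.
- by rewrite mulrDl !endoD IHu IHu' mulrDl.
Qed.

Lemma place_at_homogM k i u v :
  homog k u -> place_at (i + k) (u * v) = u * place_at i v.
Proof.
elim/homog_ind => {u} [|a s <-|u u' IHu IHu'].
- by rewrite !mul0r endo0.
- elim: s a => [|x s IH] a; first by rewrite addn0 place_atZ.
  by rewrite tgen_cons addnS -!mulrA place_atS IH.
- by rewrite !mulrDl endoD IHu IHu'.
Qed.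

Lemma homog_place_at i k u : homog k.+2 u -> homog (k + m) (place_at i u).
Proof.
elim/homog_ind => {u} [|a s|u v IHu IHv].
- by rewrite endo0; apply: homog0.
- elim: i k s a => [|i IH] k [|x s] a // [sk].
    case: s sk => // y s [sk].
    rewrite tgen_cons2 place_at0 addnC; apply: homogM; last exact: homog_gen.
    exact: bmap_homog fB _.
  rewrite tgen_cons place_atS; case: k sk => [|k] sk.
    rewrite (@place_at_small i 1) ?mulr0 //; first exact: homog0.
    exact: homog_gen.
  by apply: (@homogM 1 (k + m)); [apply: homog_tinj|apply: IH].
- by rewrite endoD; apply: homogD.
Qed.

End OnePlace.

(** Operators on disjoint pairs of factors commute; the index shifts because
    [f] replaces two factors by [m] of them. *)
Lemma place_at_comm f m f' m' j (fB : bimodule_map f m) (fB' : bimodule_map f' m') :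
  place_at fB' (j + m) * place_at fB 0 = place_at fB 0 * place_at fB' j.+2.
Proof.
apply: add_endoP; apply: (@talg_split_eq 2); try exact: endoD.
  move=> k u lt uk; rewrite !endoME (@place_at_small _ _ fB 0 k u) //.
  by rewrite (@place_at_small _ _ fB' j.+2 k) ?endo0 //; lia.
move=> u v u2; rewrite -(to_tens2K u2) !endoME place_at0 -(addn2 j).
rewrite (place_at_homogM fB' _ _ (homog_tmul2 _)) place_at0.
by rewrite (place_at_homogM fB' _ _ (bmap_homog fB _)).
Qed.

Lemma homog_place_at2 f (fB : bimodule_map f 2) i k u :
  homog k u -> homog k (place_at fB i u).
Proof.
move=> uk; have [le|lt] := leqP k i.+1.
  by rewrite (place_at_small fB le uk); apply: homog0.
case: k uk lt => [|[|k]] // uk _; rewrite -addn2.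
exact: homog_place_at fB _ _ _ uk.
Qed.

Lemma place_at0K (h h' : tens2 G -> tens2 G)
    (hB : bimodule_map (fun t => tmul2 (h t)) 2)
    (hB' : bimodule_map (fun t => tmul2 (h' t)) 2) k u :
  cancel h' h -> homog k.+2 u -> place_at hB 0 (place_at hB' 0 u) = u.
Proof.
move=> hK; elim/homog_ind => {u} [|a [|x [|y s]] // _|u v IHu IHv].
- by rewrite !endo0.
- by rewrite tgen_cons2 !place_at0 hK.
- by rewrite !endoD IHu IHv.
Qed.

(** Relations between local operators propagate from the first factors to all
    positions. *)
Lemma shift_endo_eq (F F' : nat -> add_endo T) :
  (forall i x u, F i.+1 (tinj x * u) = tinj x * F i u) ->
  (forall i x u, F' i.+1 (tinj x * u) = tinj x * F' i u) ->
  (forall i a, F i.+1 (temb G a) = F' i.+1 (temb G a)) ->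
  F 0 = F' 0 -> forall i, F i = F' i.
Proof.
move=> FS FS' Fa F0; elim=> [//|i IH]; apply: add_endoP.
elim/talg_cons_ind => [a|x u _|u v IHu IHv]; first exact: Fa.
  by rewrite FS FS' IH.
by rewrite !endoD IHu IHv.
Qed.

End Placement.

(** * The braiding and Woronowicz' antisymmetrizer *)

Lemma lift_perm_onto k (j : 'I_k.+1) :
  {on [pred w : 'S_k.+1 | w ord0 == j], bijective (lift_perm ord0 j)}.
Proof.
have inj : injective (lift_perm ord0 j : 'S_k -> 'S_k.+1).
  move=> w w' /permP e; apply/permP => i; apply: (@lift_inj _ j).
  by rewrite -!(lift_perm_lift ord0) e.
exists (fun w => odflt 1%g [pick w' | lift_perm ord0 j w' == w]) => w.
  by move=> _; case: pickP => [w' /eqP/inj //|/(_ w)]; rewrite eqxx.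
rewrite inE => /eqP <-; have [w' wE] := perm_liftE w.
by case: pickP => [? /eqP //|/(_ w')]; rewrite -wE eqxx.
Qed.

Section BraidOperators.
Variables (C : numClosedFieldType) (A : algType C) (H : hopf_star A) (n : nat).
Variables (Gam : calculus H n) (br : braiding Gam).
Local Notation G := (Gamma Gam).
Local Notation T := (talg G).
Implicit Types (a b : A) (x y z w : G) (u v : T) (t : tens2 G).

Lemma sigmaVD : {morph sigmaV br : t t' / t + t'}.
Proof. by move=> t t'; rewrite -{1}(sigmaVK br t) -{1}(sigmaVK br t') -sigmaD sigmaK. Qed.

Lemma sigmaVZ a t : sigmaV br (a *: t) = a *: sigmaV br t.
Proof. by rewrite -{1}(sigmaVK br t) -sigmaZ sigmaK. Qed.

Lemma sigmaVR t a : sigmaV br (ract2 t a) = ract2 (sigmaV br t) a.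
Proof. by rewrite -{1}(sigmaVK br t) -sigmaR sigmaK. Qed.

Lemma sigma_bimodule_map : bimodule_map (fun t => tmul2 (sigma br t)) 2.
Proof.
split=> [t t'|a t|t a|t]; first by rewrite sigmaD tmul2D.
- by rewrite sigmaZ tmul2Z.
- by rewrite sigmaR tmul2R.
- exact: homog_tmul2.
Qed.

Lemma sigmaV_bimodule_map : bimodule_map (fun t => tmul2 (sigmaV br t)) 2.
Proof.
split=> [t t'|a t|t a|t]; first by rewrite sigmaVD tmul2D.
- by rewrite sigmaVZ tmul2Z.
- by rewrite sigmaVR tmul2R.
- exact: homog_tmul2.
Qed.

Local Notation sigma_at := (place_at sigma_bimodule_map).
Local Notation sigmaV_at := (place_at sigmaV_bimodule_map).

Lemma sigma_at_far i j : (i.+1 < j)%N ->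
  sigma_at i * sigma_at j = sigma_at j * sigma_at i.
Proof.
move=> lt; have -> : j = (i + (j - i.+2).+2)%N by lia.
move: (j - i.+2)%N => {lt j} j.
apply: (@shift_endo_eq _ _ _ (fun i => sigma_at i * sigma_at (i + j.+2))
  (fun i => sigma_at (i + j.+2) * sigma_at i)) => {i}.
- by move=> i x u; rewrite !endoME !place_atS.
- by move=> i x u; rewrite !endoME !place_atS.
- by move=> i a; rewrite !endoME !(place_at_small _ _ (homog_temb _ _)) ?endo0.
- by rewrite add0n -(place_at_comm j sigma_bimodule_map) addn2.
Qed.

Lemma sigma_at_braid i :
  sigma_at i * sigma_at i.+1 * sigma_at i = sigma_at i.+1 * sigma_at i * sigma_at i.+1.
Proof.
apply: (@shift_endo_eq _ _ _
  (fun i => sigma_at i * sigma_at i.+1 * sigma_at i)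
  (fun i => sigma_at i.+1 * sigma_at i * sigma_at i.+1)) => {i}.
- by move=> i x u; rewrite !endoME !place_atS.
- by move=> i x u; rewrite !endoME !place_atS.
- by move=> i a; rewrite !endoME !(place_at_small _ _ (homog_temb _ _)) ?endo0.
apply: add_endoP; apply: (@talg_split_eq _ _ _ 3); try exact: endoD.
  move=> k u lt uk; rewrite !endoME [sigma_at 1 u](place_at_small _ _ uk) // !endo0.
  by rewrite (@place_at_small _ _ _ _ _ _ 1 k) ?endo0 //; apply: homog_place_at2.
move=> u v u3; rewrite !endoME !(@place_atMr _ _ _ _ _ _ 3) //;
  do ?apply: homog_place_at2 => //.
congr (_ * v); exact: sigma_braid u3.
Qed.

Lemma endo_sign (f : add_endo T) j u : f ((-1) ^+ j * u) = (-1) ^+ j * f u.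
Proof. by rewrite -signr_odd !mulr_sign; case: odd; rewrite ?endoN. Qed.

(** The recursion for [front_sum] splits off the empty word and pulls out the
    letter [o], with which all other words begin. *)
Lemma front_sum_sigmaE o l u :
  \sum_(j < l) (-1) ^+ j * sigma_word br (iota o j) u = front_sum sigma_at o l u.
Proof.
elim: l o => [|l IH] o; first by rewrite big_ord0.
rewrite front_sumS big_ord_recl expr0 mul1r [sigma_word _ _ _]/=.
rewrite endoDE endoNE endoME -IH endo_sum -sumrN.
congr (_ + _); apply: eq_bigr => j _; rewrite lift0 exprS mulN1r mulNr.
by rewrite endo_sign.
Qed.

Lemma partial_antisymE l u : partial_antisym br l u = front_sum sigma_at 0 l u.
Proof. exact: front_sum_sigmaE. Qed.

Lemma antisymE k u : antisym br k u = antisymmetrizer sigma_at 0 k u.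
Proof.
suff E o : \sum_(w : 'S_k) (-1) ^+ size (redword w) *
    sigma_word br (map (addn o) (redword w)) u = antisymmetrizer sigma_at o k u.
  rewrite -E; apply: eq_bigr => w _; congr (_ * sigma_word _ _ _).
  by rewrite -[LHS]map_id; apply: eq_map.
(* A permutation of [k.+1] letters is the image [j] of the first letter
   together with a permutation [w] of the others, and its reduced word is
   that of [w], shifted, followed by [0 ... j-1]. *)
elim: k o u => [|k IH] o u.
  rewrite (big_pred1 1%g) => [|w]; last first.
    by apply/esym/eqP/permP => -[].
  by rewrite /redword enum_ord0 /= mul1r.
rewrite antisymmetrizerS endoME -front_sum_sigmaE.
rewrite endo_sum (partition_big (fun w : 'S_k.+1 => w ord0) xpredT) //=.
apply: eq_bigr => j _; rewrite (reindex (lift_perm ord0 j)) /=; last first.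
  exact: lift_perm_onto.
rewrite (eq_bigl xpredT) => [|w]; last by rewrite lift_perm_id eqxx.
rewrite endo_sign -IH mulr_sumr; apply: eq_bigr => w _.
rewrite redword_lift size_cat size_map size_iota map_cat -map_comp.
rewrite -iotaDl addn0 /sigma_word foldr_cat -/(sigma_word _ _ _).
rewrite addnC exprD -mulrA; congr (_ * (_ * foldr _ _ _)).
by apply: eq_map => i /=; rewrite addnS.
Qed.

(** * The exterior algebra is a ring quotient *)

Definition lmul u : add_endo T := AddEndo (mulrDr u).
Definition rmul u : add_endo T :=
  @AddEndo T (fun v => v * u) (fun v v' => mulrDl v v' u).
Definition hproj_endo k : add_endo T := AddEndo (@hprojD _ _ G k).

Local Notation Asym := (antisymmetrizer sigma_at).
Local Notation B := (front_sum sigma_at).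

Lemma ker_antisym_homog k u : homog k u -> Asym 0 k u = 0 -> u \in ker_antisym br.
Proof.
move=> uk Au; apply/asboolP => j; rewrite (hproj_homog j uk).
by case: eqP => [->|_]; rewrite ?antisym0 // antisymE.
Qed.

Lemma ker_antisym_hproj k u : u \in ker_antisym br -> Asym 0 k (hproj k u) = 0.
Proof. by move=> /asboolP/(_ k); rewrite antisymE. Qed.

Lemma antisym_tinjM k x u : Asym 1 k (tinj x * u) = tinj x * Asym 0 k u.
Proof.
have e : lmul (tinj x) * Asym 0 k = Asym 1 k * lmul (tinj x).
  apply: (@antisymmetrizer_intertwine _ sigma_at _ 0 1 k _ k 0) => // i _.
  by apply: add_endoP => v; rewrite !endoME addn1 addn0; apply/esym/place_atS.
by have /(congr1 (fun f : add_endo T => f u)) := e.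
Qed.

Lemma hproj_sigma k i u : hproj k (sigma_at i u) = sigma_at i (hproj k u).
Proof.
elim/talg_ind: u => [|a s|u v IHu IHv].
- by rewrite endo0 !hproj0 endo0.
- have hs := @homog_gen _ _ G _ a s erefl.
  rewrite (hproj_homog k hs) (hproj_homog k (homog_place_at2 sigma_bimodule_map i hs)).
  by case: ifP; rewrite ?endo0.
- by rewrite endoD !hprojD IHu IHv endoD.
Qed.

(** Cutting down to degree [k] first makes right multiplication by [v] commute
    with all braid generators that occur in the antisymmetrizer. *)
Lemma antisym_Mr k u v : homog k u -> Asym 0 k u = 0 -> Asym 0 k (u * v) = 0.
Proof.
move=> uk Au.
have e : rmul v * hproj_endo k * Asym 0 k = Asym 0 k * (rmul v * hproj_endo k).
  apply: (@antisymmetrizer_intertwine _ sigma_at _ 0 0 k.-1 _ k 0); last by lia.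
  move=> i lt; apply: add_endoP => w; rewrite !endoME addn0.
  transitivity (sigma_at i (hproj k w) * v); first by rewrite -hproj_sigma.
  by apply/esym/(@place_atMr _ _ _ _ _ _ k); [lia|apply: homog_hproj].
have /(congr1 (fun f : add_endo T => f u)) := e.
by rewrite !endoME [hproj_endo k u]uk Au !endo0.
Qed.

(** [A_(k+1) (x u)] factors through [x A_k u]. *)
Lemma ker_antisymMl v u : u \in ker_antisym br -> v * u \in ker_antisym br.
Proof.
move=> uK; elim/talg_cons_ind: v => [a|x v vuK|v v' vK vK'].
- exact: ker_antisymZ.
- rewrite -mulrA [v * u]hproj_sum mulr_sumr; apply: rpred_sum => k _.
  apply: (@ker_antisym_homog k.+1); first exact: homog_tinjM (homog_hproj k _).
  rewrite antisymmetrizerS_rev; last exact: sigma_at_far.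
  by rewrite endoME antisym_tinjM ker_antisym_hproj // mulr0 endo0.
- by rewrite mulrDl rpredD.
Qed.

(** [A_(k+1) (u x)] factors through [(A_k u) x]. *)
Lemma ker_antisymMr v u : u \in ker_antisym br -> u * v \in ker_antisym br.
Proof.
move=> uK; elim/talg_cons_ind: v u uK => [a|x v IH|v v' IHv IHv'] u uK.
- rewrite [u]hproj_sum mulr_suml; apply: rpred_sum => k _.
  apply: (@ker_antisym_homog k).
    exact: homogM_temb (homog_hproj k _).
  by apply: antisym_Mr; [apply: homog_hproj|apply: ker_antisym_hproj].
- rewrite mulrA; apply: IH.
  rewrite [u]hproj_sum mulr_suml; apply: rpred_sum => k _.
  apply: (@ker_antisym_homog k.+1).
    exact: homogM_tinj (homog_hproj k _).
  rewrite antisymmetrizerS_back; [|exact: sigma_at_far|exact: sigma_at_braid].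
  rewrite endoME antisym_Mr ?endo0 //; first exact: homog_hproj.
  exact: ker_antisym_hproj.
- by rewrite mulrDr rpredD ?IHv ?IHv'.
Qed.

Lemma wedge_pi u v : wedge (ext_pi br u) (ext_pi br v) = ext_pi br (u * v).
Proof.
apply/ext_eqP; set u' := ext_repr _; set v' := ext_repr _.
have -> : u' * v' - u * v = (u' - u) * v' + u * (v' - v).
  by rewrite mulrBl mulrBr addrA subrK.
by apply: rpredD; [apply: ker_antisymMr|apply: ker_antisymMl];
  apply/ext_eqP; rewrite ext_reprK.
Qed.

(** * The contraction descends to the exterior algebra *)

Section Metric.
Variable g : sigma_metric br.

Lemma met_bimodule_map : bimodule_map (fun t => temb G (met g t)) 0.
Proof.
split=> [t t'|a t|t a|t]; first by rewrite metD tembD.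
- by rewrite metZ tembM.
- by rewrite metR tembM.
- exact: homog_temb.
Qed.

Local Notation met_at := (place_at met_bimodule_map).

(** The compatibility of the metric with [h] on three factors, composed with the
    inverse [h'] on the first two; in this form it also holds in low degrees. *)
Lemma met_slide (h h' : tens2 G -> tens2 G)
    (hB : bimodule_map (fun t => tmul2 (h t)) 2)
    (hB' : bimodule_map (fun t => tmul2 (h' t)) 2) (i : nat) :
  cancel h' h ->
  (forall u, homog 3 u ->
    leg0 (met g) 0 (leg2 h 1 (leg2 h 0 u)) = leg0 (met g) 1 u) ->
  met_at i * place_at hB i.+1 = met_at i.+1 * place_at hB' i.
Proof.
move=> hK leg; apply: (@shift_endo_eq _ _ _ (fun i => met_at i * place_at hB i.+1)
  (fun i => met_at i.+1 * place_at hB' i)) => {i}.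
- by move=> i x u; rewrite !endoME !place_atS.
- by move=> i x u; rewrite !endoME !place_atS.
- by move=> i a; rewrite !endoME !(place_at_small _ _ (homog_temb _ _)) ?endo0.
apply: add_endoP; apply: (@talg_split_eq _ _ _ 3); try exact: endoD.
  move=> k u lt uk; rewrite !endoME [place_at hB 1 u](place_at_small _ _ uk) // !endo0.
  by rewrite (@place_at_small _ _ _ _ _ _ 1 k) ?endo0 //; apply: homog_place_at2.
move=> u v u3; have hu3 := homog_place_at2 hB' 0 u3.
rewrite !endoME !(@place_atMr _ _ _ _ _ _ 3) //; last exact: homog_place_at2.
have : met_at 0 (place_at hB 1 (place_at hB 0 (place_at hB' 0 u)))
    = met_at 1 (place_at hB' 0 u).
  exact (leg _ hu3).
by rewrite (place_at0K hB hB' hK u3) => ->.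
Qed.

Lemma met_sigma_at i : met_at i * sigma_at i.+1 = met_at i.+1 * sigmaV_at i.
Proof. by apply: met_slide; [apply: sigmaVK|apply: met_leg]. Qed.

Lemma met_sigmaV_at i : met_at i * sigmaV_at i.+1 = met_at i.+1 * sigma_at i.
Proof. by apply: met_slide; [apply: sigmaK|apply: met_leg']. Qed.

(** Contracting the two inner ones of four factors and then the two outer ones,
    a braiding of the last two factors can be replaced by one of the first two:
    slide either of them through the inner contraction; what remains is
    [g ⊗ g] after the inverse braiding of the two middle factors. *)
Lemma met_met_sigma :
  met_at 0 * met_at 1 * sigma_at 2 = met_at 0 * met_at 1 * sigma_at 0.
Proof.
rewrite -!mulrA met_sigma_at -met_sigmaV_at !mulrA; congr (_ * _).
exact/esym/(place_at_comm 0 met_bimodule_map met_bimodule_map).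
Qed.

Lemma met_at0_sigma i : sigma_at i * met_at 0 = met_at 0 * sigma_at i.+2.
Proof. by rewrite -(place_at_comm i met_bimodule_map) addn0. Qed.

(** The bound of the sum in [contr] depends on the argument; a larger common
    bound gives additivity. *)
Lemma contr_sum w N u : (tdeg u < N)%N ->
  contr g w u = \sum_(l < N) met_at 0 (tinj w * B 0 l (hproj l u)).
Proof.
move=> lt; pose F l := met_at 0 (tinj w * B 0 l (hproj l u)).
rewrite [LHS](_ : _ = \sum_(l < (tdeg u).+1) F l); last first.
  by apply: eq_bigr => l _; rewrite partial_antisymE.
rewrite (big_ord_widen N F lt) [RHS](bigID (fun l : 'I_N => (l <= tdeg u)%N)).
rewrite -[LHS]addr0; congr (_ + _); apply/esym/big1 => l /andP[_]; rewrite -ltnNge => ltl.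
by rewrite hproj_gt_tdeg // endo0 mulr0 endo0.
Qed.

Lemma contrD w : {morph contr g w : u v / u + v}.
Proof.
move=> u v; pose N := (maxn (tdeg (u + v)) (maxn (tdeg u) (tdeg v))).+1.
rewrite !(@contr_sum w N) ?ltnS ?leq_max ?leqnn ?orbT // -big_split.
by apply: eq_bigr => l _; rewrite hprojD !endoD mulrDr endoD.
Qed.

Definition contr_endo w : add_endo T := AddEndo (contrD w).

Lemma contr_homog l w u : homog l u -> contr g w u = met_at 0 (tinj w * B 0 l u).
Proof.
move=> ul; have lt : (l < (maxn l (tdeg u)).+1)%N by rewrite ltnS leq_maxl.
rewrite (@contr_sum w (maxn l (tdeg u)).+1) ?ltnS ?leq_maxr //.
rewrite (bigD1 (Ordinal lt)) // [hproj _ u]ul big1 => [|j ne]; first exact: addr0.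
rewrite (hproj_homog j ul); case: eqP => [e|_]; last by rewrite endo0 mulr0 endo0.
by case/eqP: ne; apply: val_inj.
Qed.

Lemma homog_front_sum o l k u : homog k u -> homog k (B o l u).
Proof.
move=> uk; elim: l o => [|l IH] o; first exact: homog0.
rewrite front_sumS endoDE endoNE endoME endo1E.
by rewrite /homog hprojD hprojN uk (homog_place_at2 sigma_bimodule_map _ (IH _)).
Qed.

Lemma contr_deg0 w u : homog 0 u -> contr g w u = 0.
Proof.
by move=> /contr_homog ->; rewrite -[B 0 0]/(0 : add_endo T) endo0E mulr0 endo0.
Qed.

Lemma homog_contr l w u : homog l.+1 u -> homog l (contr g w u).
Proof.
move=> ul; rewrite (contr_homog _ ul) -(addn0 l).
by apply/(@homog_place_at _ _ _ _ _ met_bimodule_map)/homog_tinjM/homog_front_sum.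
Qed.

(** Contraction with [w] carries the antisymmetrizer of the last [k] factors to
    that of [k] factors, and composed with [B_(1,k)] the former is [A_(k+1)]. *)
Lemma ker_antisym_contr w u : u \in ker_antisym br -> contr g w u \in ker_antisym br.
Proof.
move=> uK; rewrite [u]hproj_sum -[contr g w _]/(contr_endo w _) endo_sum.
apply: rpred_sum => k _.
move: (homog_hproj k u) (ker_antisym_hproj k uK); move: (hproj k u) => {uK} v vk Av.
rewrite /=; case: {k}(k : nat) vk Av => [|k] vk Av; first by rewrite contr_deg0 ?rpred0.
apply: (ker_antisym_homog (homog_contr _ vk)); rewrite (contr_homog _ vk).
have e : met_at 0 * lmul (tinj w) * Asym 1 k = Asym 0 k * (met_at 0 * lmul (tinj w)).
  apply: (@antisymmetrizer_intertwine _ sigma_at _ 1 0 k _ k 0) => // i _.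
  rewrite mulrA addn1 addn0 met_at0_sigma -!mulrA; congr (_ * _).
  by apply: add_endoP => z; rewrite !endoME; apply/esym/place_atS.
have /(congr1 (fun f : add_endo T => f (B 0 k.+1 v))) := e; rewrite !endoME => <-.
by rewrite (Av : Asym 1 k (B 0 k.+1 v) = 0) !endo0.
Qed.

Lemma ext_contr_pi w u : ext_contr g w (ext_pi br u) = ext_pi br (contr g w u).
Proof.
apply/ext_eqP; rewrite -![contr g w _]/(contr_endo w _) -endoN -endoD.
by apply: ker_antisym_contr; apply/ext_eqP; rewrite ext_reprK.
Qed.

End Metric.

End BraidOperators.

(** * The universal property of the tensor algebra *)

Section UniversalProperty.
Variables (C : fieldType) (A : algType C) (G : bimodule A) (Q : pzRingType).
Variables (alpha : A -> Q) (beta : G -> Q).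
Hypothesis alphaD : {morph alpha : a b / a + b}.
Hypothesis alphaM : {morph alpha : a b / a * b}.
Hypothesis alpha1 : alpha 1 = 1.
Hypothesis betaD : {morph beta : x y / x + y}.
Hypothesis betaZ : forall a x, beta (a *: x) = alpha a * beta x.
Hypothesis betaR : forall x a, beta (ract x a) = beta x * alpha a.
Implicit Types (a b : A) (x y : G) (s : seq G) (u v : talg G).

Definition word_eval a s : Q := alpha a * \prod_(x <- s) beta x.

Lemma word_eval_compat : talg_compat word_eval.
Proof.
split=> [a b s|a s x y t|a b x t|a s x b y t]; rewrite /word_eval.
- by rewrite alphaD mulrDl.
- by rewrite !big_cat !big_cons /= betaD mulrDl !mulrDr.
- by rewrite !big_cons betaZ alphaM !mulrA.
- by rewrite !big_cat !big_cons /= betaR betaZ !mulrA.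
Qed.

Definition talg_eval : talg G -> Q := talg_lift word_eval.

Lemma talg_evalD : {morph talg_eval : u v / u + v}.
Proof. exact: talg_liftD word_eval_compat. Qed.

Lemma talg_eval0 : talg_eval 0 = 0.
Proof. exact: talg_lift0 word_eval_compat. Qed.

Lemma talg_eval_gen a s : talg_eval (tgen a s) = word_eval a s.
Proof. exact: talg_lift_gen word_eval_compat. Qed.

Lemma talg_eval_temb a : talg_eval (temb G a) = alpha a.
Proof. by rewrite talg_eval_gen /word_eval big_nil mulr1. Qed.

Lemma talg_eval_tinj x : talg_eval (tinj x) = beta x.
Proof. by rewrite talg_eval_gen /word_eval big_seq1 alpha1 mul1r. Qed.

Lemma talg_evalM : {morph talg_eval : u v / u * v}.
Proof.
have tembM_eval a v : talg_eval (temb G a * v) = alpha a * talg_eval v.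
  elim/talg_ind: v => [|b s|v v' IH IH'].
  - by rewrite mulr0 talg_eval0 mulr0.
  - by rewrite tgenM !talg_eval_gen /word_eval alphaM mulrA.
  - by rewrite mulrDr !talg_evalD IH IH' mulrDr.
have tinjM_eval x v : talg_eval (tinj x * v) = beta x * talg_eval v.
  elim/talg_ind: v => [|b s|v v' IH IH'].
  - by rewrite mulr0 talg_eval0 mulr0.
  - by rewrite tgenM !talg_eval_gen /word_eval big_cons alpha1 mul1r betaR mulrA.
  - by rewrite mulrDr !talg_evalD IH IH' mulrDr.
move=> u v; elim/talg_cons_ind: u => [a|x u IH|u u' IH IH'].
- by rewrite tembM_eval talg_eval_temb.
- by rewrite -mulrA !tinjM_eval IH mulrA.
- by rewrite mulrDl !talg_evalD IH IH' mulrDl.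
Qed.

Lemma talg_eval_tmul2 (t : tens2 G) :
  talg_eval (tmul2 t) = \sum_(p <- repA t) beta p.1 * beta p.2.
Proof.
rewrite (big_morph _ talg_evalD talg_eval0); apply: eq_bigr => p _.
by rewrite talg_evalM !talg_eval_tinj.
Qed.

End UniversalProperty.

(** * The action of the Clifford algebra *)

Section CliffordAction.
Variables (C : numClosedFieldType) (A : algType C) (H : hopf_star A) (n : nat).
Variables (Gam : calculus H n) (br : braiding Gam) (g : sigma_metric br).
Local Notation G := (Gamma Gam).
Local Notation T := (talg G).
Implicit Types (a b : A) (x y z w : G) (u v : T) (t : tens2 G).

Local Notation sigma_at := (place_at (sigma_bimodule_map br)).
Local Notation sigmaV_at := (place_at (sigmaV_bimodule_map br)).
Local Notation met_at := (place_at (met_bimodule_map g)).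
Local Notation B := (front_sum sigma_at).

Lemma contrDl x y u : contr g (x + y) u = contr g x u + contr g y u.
Proof.
rewrite /contr -big_split; apply: eq_bigr => l _.
by rewrite tinjD mulrDl [LHS](endoD (met_at 0)).
Qed.

Lemma contrZ a x u : contr g (a *: x) u = a *: contr g x u.
Proof.
rewrite /contr scaler_sumr; apply: eq_bigr => l _.
by rewrite tinjZ -mulrA [LHS](place_atZ (met_bimodule_map g)).
Qed.

Lemma front_sumZ o l a u : B o l (temb G a * u) = temb G a * B o l u.
Proof.
have e : lmul (temb G a) * B o l = B o l * lmul (temb G a).
  apply: (@front_sum_intertwine _ sigma_at _ o o l _ l 0) => // i _.
  by apply: add_endoP => v; rewrite !endoME; apply/esym/place_atZ.
by have /(congr1 (fun f : add_endo T => f u)) := e.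
Qed.

Lemma contrR x a u : contr g (ract x a) u = contr g x (temb G a * u).
Proof.
elim/talg_ind: u => [|b s|u v IHu IHv].
- by rewrite mulr0 -![contr g _ _]/(contr_endo g _ _) !endo0.
- have hs := @homog_gen _ _ G _ b s erefl.
  rewrite (contr_homog _ _ hs) (@contr_homog _ _ _ _ _ _ _ (size s)).
    by rewrite front_sumZ tinjR mulrA.
  exact: (@homogM _ _ _ 0 _ _ _ (homog_temb G a) hs).
- by rewrite mulrDr !contrD IHu IHv.
Qed.

Lemma clifford_op_subproof w : {morph (fun x : ext br =>
  wedge (ext_pi br (tinj w)) x + ext_contr g w x) : x y / x + y}.
Proof.
move=> x y /=; rewrite -[x]ext_reprK -[y]ext_reprK -ext_piD.
rewrite !wedge_pi !ext_contr_pi -!ext_piD; congr ext_pi.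
by rewrite mulrDr contrD addrACA.
Qed.

Definition clifford_op w : add_endo (ext br) := AddEndo (clifford_op_subproof w).

Definition scale_op a : add_endo (ext br) := AddEndo (scalerDr a).

Lemma clifford_op_pi w u :
  clifford_op w (ext_pi br u) = ext_pi br (tinj w * u + contr g w u).
Proof. by rewrite /= wedge_pi ext_contr_pi ext_piD. Qed.

Lemma scale_op_pi a u : scale_op a (ext_pi br u) = ext_pi br (temb G a * u).
Proof. exact: ext_scaleE. Qed.

Lemma ext_endoP (f f' : add_endo (ext br)) :
  (forall u, f (ext_pi br u) = f' (ext_pi br u)) -> f = f'.
Proof. by move=> ff'; apply: add_endoP => x; rewrite -[x]ext_reprK. Qed.

Lemma scale_opD : {morph scale_op : a b / a + b}.
Proof. by move=> a b; apply: add_endoP => x; apply: scalerDl. Qed.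

Lemma scale_opM : {morph scale_op : a b / a * b}.
Proof. by move=> a b; apply: add_endoP => x; apply/esym/scalerA. Qed.

Lemma scale_op1 : scale_op 1 = 1.
Proof. by apply: add_endoP => x; apply: scale1r. Qed.

Lemma clifford_opD : {morph clifford_op : x y / x + y}.
Proof.
move=> x y; apply: ext_endoP => u; rewrite endoDE !clifford_op_pi -ext_piD.
by rewrite tinjD mulrDl contrDl addrACA.
Qed.

Lemma clifford_opZ a x : clifford_op (a *: x) = scale_op a * clifford_op x.
Proof.
apply: ext_endoP => u; rewrite endoME !clifford_op_pi scale_op_pi.
by rewrite tinjZ contrZ mulrDr mulrA.
Qed.

Lemma clifford_opR x a : clifford_op (ract x a) = clifford_op x * scale_op a.
Proof.
apply: ext_endoP => u; rewrite endoME scale_op_pi !clifford_op_pi.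
by rewrite tinjR contrR mulrA.
Qed.

Lemma front_sum_tinjM l x u : B 1 l (tinj x * u) = tinj x * B 0 l u.
Proof.
have e : lmul (tinj x) * B 0 l = B 1 l * lmul (tinj x).
  apply: (@front_sum_intertwine _ sigma_at _ 0 1 l _ l 0) => // i _.
  by apply: add_endoP => v; rewrite !endoME addn1 addn0; apply/esym/place_atS.
by have /(congr1 (fun f : add_endo T => f u)) := e.
Qed.

(** Expand [B_(1,l) (y u) = y u - sigma_12 (y B_(1,l-1) u)]. *)
Lemma contr_tinjM l x y u : homog l u ->
  contr g x (tinj y * u) = met_at 0 (tinj x * tinj y * u)
    - met_at 0 (sigma_at 1 (tinj x * tinj y * B 0 l u)).
Proof.
move=> ul; rewrite (contr_homog _ _ (homog_tinjM y ul)) front_sumS.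
rewrite endoDE endoNE endoME endo1E front_sum_tinjM.
by rewrite mulrBr endoD endoN -!mulrA place_atS.
Qed.

Lemma tinj_contr l x y u : homog l u ->
  tinj x * contr g y u = met_at 1 (tinj x * tinj y * B 0 l u).
Proof. by move=> ul; rewrite (contr_homog _ _ ul) -mulrA place_atS. Qed.

Lemma contr_contr l x y u : homog l u ->
  contr g x (contr g y u) =
  met_at 0 (met_at 1 (tinj x * tinj y * B 1 l.-1 (B 0 l u))).
Proof.
case: l => [|l] ul.
  rewrite (contr_deg0 _ _ ul) -[contr g x 0]/(contr_endo g x 0).
  by rewrite -[B 1 0.-1]/(0 : add_endo T) endo0E mulr0 !endo0.
rewrite (contr_homog _ _ (homog_contr _ _ ul)) (contr_homog _ _ ul).
have e : met_at 0 * lmul (tinj y) * B 1 l = B 0 l * (met_at 0 * lmul (tinj y)).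
  apply: (@front_sum_intertwine _ sigma_at _ 1 0 l _ l 0) => // i _.
  rewrite mulrA addn1 addn0 met_at0_sigma -!mulrA; congr (_ * _).
  by apply: add_endoP => z; rewrite !endoME; apply/esym/place_atS.
have /(congr1 (fun f : add_endo T => f (B 0 l.+1 u))) := e; rewrite !endoME => <-.
by rewrite -mulrA place_atS.
Qed.

Lemma rmulE u v : rmul u v = v * u. Proof. by []. Qed.

(** The effect of two Clifford operators [x], [y] on a representative of degree
    [l], as an additive function of [x ⊗ y], so that it extends to sums of pure
    tensors. *)
Definition double_action l u : add_endo T :=
  rmul u + met_at 1 * rmul (B 0 l u)
  + (met_at 0 * rmul u - met_at 0 * sigma_at 1 * rmul (B 0 l u)
     + met_at 0 * met_at 1 * rmul (B 1 l.-1 (B 0 l u))).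

Lemma clifford_op2 l x y u : homog l u ->
  clifford_op x (clifford_op y (ext_pi br u)) =
  ext_pi br (double_action l u (tinj x * tinj y)).
Proof.
move=> ul; rewrite !clifford_op_pi; congr ext_pi.
rewrite mulrDr contrD (contr_tinjM x y ul) (tinj_contr x y ul) (contr_contr x y ul).
by rewrite /double_action !(endoDE, endoNE, endoME, rmulE) !mulrA.
Qed.

(** For a sigma-invariant 2-tensor [t] the terms of degree [l] other than
    [g(t) u] cancel, as [g_23] on [t ⊗ v] is then [g_12 sigma_23], and the double
    contraction vanishes: by [front_sum2] it is applied to [(1 - sigma) v],
    and by [met_met_sigma] the braiding can be moved from [v] to [t]. *)
Lemma double_action_sigma_inv l u t : homog l u -> sigma br t = t ->
  double_action l u (tmul2 t) = tmul2 t * u + temb G (met g t) * u.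
Proof.
move=> ul st; have sVt : sigmaV br t = t by rewrite -{1}st sigmaK.
rewrite /double_action !(endoDE, endoNE, endoME, rmulE) -addrA; congr (_ + _).
rewrite place_at0 [X in X = _]addrC.
have -> : met_at 0 (sigma_at 1 (tmul2 t * B 0 l u)) = met_at 1 (tmul2 t * B 0 l u).
  rewrite -[LHS]endoME met_sigma_at endoME place_at0 sVt //.
have -> : met_at 0 (met_at 1 (tmul2 t * B 1 l.-1 (B 0 l u))) = 0.
  case: l {ul} => [|l]; first by rewrite -[B 1 0.-1]/(0 : add_endo T) endo0E mulr0 !endo0.
  have [y /(congr1 (fun f : add_endo T => f u))] :=
    front_sum2 (@sigma_at_far _ _ _ _ _ br) (@sigma_at_braid _ _ _ _ _ br) 0 l.
  rewrite !endoME => ->; rewrite endoDE endoNE endo1E mulrBr !endoD !endoN.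
  rewrite -(place_at_homogM (sigma_bimodule_map br) 0 (y u) (homog_tmul2 t)).
  have /(congr1 (fun f : add_endo T => f (tmul2 t * y u))) := met_met_sigma g.
  by rewrite !endoME => ->; rewrite place_at0 st subrr.
by rewrite addr0 addrNK.
Qed.

Lemma sigma_inv_ker t : sigma br t = t -> tmul2 t \in ker_antisym br.
Proof.
move=> st; apply: (@ker_antisym_homog _ _ _ _ _ _ 2); first exact: homog_tmul2.
have -> : antisymmetrizer sigma_at 0 2 = 1 - sigma_at 0.
  by rewrite !antisymmetrizerS !front_sumS -[front_sum _ _ 0]/(0 : add_endo T)
    !mulr0 !subr0 !mulr1 !mul1r.
by rewrite endoDE endoNE endo1E -[tmul2 t]mulr1 place_at0 st subrr.
Qed.

(** The defining relations of the Clifford algebra: the exterior product of an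
    invariant [t] vanishes, so [double_action_sigma_inv] leaves only [g(t)]. *)
Lemma clifford_relation t : sigma br t = t ->
  \sum_(p <- repA t) clifford_op p.1 * clifford_op p.2 = scale_op (met g t).
Proof.
move=> st; have pi0 : ext_pi br 0 = 0.
  by apply: (@addrI _ (ext_pi br 0)); rewrite -ext_piD !addr0.
apply: ext_endoP; elim/talg_ind => [|a s|u v IHu IHv].
- by rewrite pi0 !endo0.
- move: (@homog_gen _ _ G _ a s erefl); move: (size s) (tgen a s) => l u ul.
  rewrite endo_sumE (eq_bigr _ (fun p _ => clifford_op2 p.1 p.2 ul)).
  rewrite -(big_morph _ (@ext_piD _ _ _ _ _ br) pi0) -endo_sum.
  rewrite (double_action_sigma_inv ul st) scale_op_pi; apply/ext_eqP.
  by rewrite addrK; apply/ker_antisymMr/sigma_inv_ker.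
- by rewrite ext_piD !endoD IHu IHv.
Qed.

Definition talg_action : T -> add_endo (ext br) := talg_eval scale_op clifford_op.

Lemma talg_actionD : {morph talg_action : u v / u + v}.
Proof. exact: talg_evalD scale_opD scale_opM clifford_opD clifford_opZ clifford_opR. Qed.

Lemma talg_actionM : {morph talg_action : u v / u * v}.
Proof.
exact: talg_evalM scale_opD scale_opM scale_op1 clifford_opD clifford_opZ clifford_opR.
Qed.

Lemma talg_action_temb a : talg_action (temb G a) = scale_op a.
Proof. exact: talg_eval_temb scale_opD scale_opM clifford_opD clifford_opZ clifford_opR a. Qed.

Lemma talg_action_tinj x : talg_action (tinj x) = clifford_op x.
Proof.
exact: talg_eval_tinj scale_opD scale_opM scale_op1 clifford_opD clifford_opZ clifford_opR x.
Qed.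

Lemma talg_action_tmul2 t :
  talg_action (tmul2 t) = \sum_(p <- repA t) clifford_op p.1 * clifford_op p.2.
Proof.
exact: talg_eval_tmul2 scale_opD scale_opM scale_op1 clifford_opD clifford_opZ clifford_opR t.
Qed.

Lemma talg_action0 : talg_action 0 = 0.
Proof. by apply: (@addrI _ (talg_action 0)); rewrite -talg_actionD !addr0. Qed.

Lemma talg_actionN u : talg_action (- u) = - talg_action u.
Proof. by apply/eqP; rewrite -addr_eq0 -talg_actionD addNr talg_action0. Qed.

Lemma talg_action_ideal u : u \in cl_ideal g -> talg_action u = 0.
Proof.
move=> /asboolP[s sS ->].
rewrite (big_morph _ talg_actionD talg_action0) big_seq big1 // => p /sS st.
rewrite !talg_actionM talg_actionD talg_actionN talg_action_temb.
by rewrite talg_action_tmul2 clifford_relation // subrr mulr0 mul0r.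
Qed.

Lemma temb_scalar_comm (c : C) u : temb G c%:A * u = u * temb G c%:A.
Proof.
elim/talg_cons_ind: u => [a|x u IH|u v IHu IHv].
- by rewrite -!tembM -scalerAl -scalerAr mul1r mulr1.
- by rewrite mulrA -tinjZ -ractC tinjR -!mulrA IH.
- by rewrite mulrDr mulrDl IHu IHv.
Qed.

Definition clifford_action (c : clifford g) (x : ext br) : ext br :=
  talg_action (cl_repr c) x.

Lemma clifford_action_pi u (x : ext br) : clifford_action (cl_pi g u) x = talg_action u x.
Proof.
rewrite /clifford_action; congr (endo_fun _ x); apply/eqP; rewrite -subr_eq0.
rewrite -talg_actionN -talg_actionD talg_action_ideal //.
by apply/cl_eqP; rewrite cl_reprK.
Qed.

Lemma clifford_action_representation : cl_representation clifford_action.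
Proof.
split=> [c d d' x|d c x y|x|d d' x].
- rewrite -[d]cl_reprK -[d']cl_reprK [_ * _]cl_mulE -cl_piD !clifford_action_pi.
  by rewrite talg_actionD talg_actionM talg_action_temb.
- rewrite /clifford_action endoD; congr (_ + _).
  rewrite -[c%:A *: x]/(scale_op c%:A x) -talg_action_temb -endoME -talg_actionM.
  by rewrite -temb_scalar_comm talg_actionM talg_action_temb.
- by rewrite [LHS]clifford_action_pi -temb1 talg_action_temb scale_op1.
- rewrite -[d]cl_reprK -[d']cl_reprK [_ * _]cl_mulE !clifford_action_pi.
  by rewrite talg_actionM.
Qed.

Lemma clifford_action_formulas : cl_action_formulas clifford_action.
Proof.
split=> [a x|w x]; first by rewrite clifford_action_pi talg_action_temb.
by rewrite clifford_action_pi talg_action_tinj.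
Qed.

(** The Clifford algebra is generated by [A] and [G]. *)
Lemma clifford_action_unique (r r' : clifford g -> ext br -> ext br) :
  cl_representation r -> cl_action_formulas r ->
  cl_representation r' -> cl_action_formulas r' -> r = r'.
Proof.
have rD (f : clifford g -> ext br -> ext br) d d' (x : ext br) :
    cl_representation f -> f (d + d') x = f d x + f d' x.
  case=> flin _ _ _; have := flin 1 d d' x.
  rewrite !scale1r.
  have -> : cl_emb g 1 = 1 by [].
  by rewrite mul1r.
move=> rr [rA rG] rr' [rA' rG']; apply/funext => d; apply/funext => x.
rewrite -[d]cl_reprK; move: (cl_repr d) => {d} u.
elim/talg_cons_ind: u x => [a|y u IH|u v IHu IHv] x.
- by rewrite [LHS]rA [RHS]rA'.
- rewrite -cl_mulE -[cl_mul _ _]/(cl_inj g y * cl_pi g u).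
  by case: rr rr' => _ _ _ -> [_ _ _ ->]; rewrite rG rG' IH.
- by rewrite cl_piD !rD // IHu IHv.
Qed.

End CliffordAction.

Theorem proposition3p2 (R : realType) (A : algType R[i]) (H : hopf_star A)
    (n : nat) (Gam : calculus H n) (br : braiding Gam) (g : sigma_metric br) :
  cosemisimple H ->
  [/\ (* the product and the contraction descend to the external algebra *)
      forall u v : talg (Gamma Gam),
        wedge (ext_pi br u) (ext_pi br v) = ext_pi br (u * v),
      forall (w : Gamma Gam) (u : talg (Gamma Gam)),
        ext_contr g w (ext_pi br u) = ext_pi br (contr g w u) &
      exists! r : clifford g -> ext br -> ext br,
        cl_representation r /\ cl_action_formulas r].
Proof.
move=> _; split; [exact: wedge_pi|exact: ext_contr_pi|].
exists (@clifford_action _ _ _ _ _ _ g); split.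
  split; [exact: clifford_action_representation|exact: clifford_action_formulas].
move=> r [rr rf]; apply: clifford_action_unique rr rf => //.
- exact: clifford_action_representation.
- exact: clifford_action_formulas.
Qed.
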